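(* Consider a district heating network whose supply network and return network are modeled by polytrees, as described in the context, and assume that every demand node is an outgoing node localized in front of a consumer or a power plant. Assume that for all consumers $$Q_k(t)>0\quad\text{for all }t\in I,\qquad k=1,\dots,n_c.$$ Then the semi-explicit differential-algebraic equation (the reduced network DAE, obtained by neglecting $\dot v$, given in the context) $$\dot x_1=f_1(t,x_1,x_2,y),\qquad 0=f_2(t,x_1,x_2,y),\qquad 0=g_1(t,x_1,x_2,y),\qquad 0=g_2(t,x_1,x_2)$$ has differentiation index $1$, and $v_i(t)>0$ holds for all $t\in I$ in every pipe $e_i$, $i=1,\dots,N$.
   Context: Graph. The network is a finite directed graph $\mathcal G=(\mathcal N,\mathcal E)$ with pipes $\mathcal E=\{e_1,\dots,e_N\}$. Nodes are split into supply nodes, demand nodes and interior (junction) nodes; supply and demand nodes are the only boundary nodes, each attached to exactly one pipe, directed away from a supply node (supply pipe) and towards a demand node (demand pipe); interior nodes are attached to at least two pipes. There are $n_s$ supply, $n_d$ demand and $n_{junc}$ interior nodes. There are $n_c$ consumers and exactly one power plant, so $n_s-n_c=n_d-n_c=1$. Consumers and the power plant are ''breaks'' in the network: each is located between a demand node (in front of it) and a supply node (after it), and they are not edges of $\mathcal G$. Thus $\mathcal G$ consists of a supply network (hot water from the supply node after the power plant to the demand nodes in front of the consumers) and a return network (from the supply nodes after the consumers to the demand node in front of the power plant). A polytree is a directed acyclic graph whose underlying undirected graph is a tree. Pipes are numbered so that $e_1$ is the supply pipe after the power plant and $e_N$ is the demand pipe before the power plant. The flow direction is fixed a priori as the direction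 of the pipes: $v_i\ge 0$. Variables. Pipe $e_i$ has length $L_i>0$, diameter $d_i>0$, cross section $A_i=\pi(d_i/2)^2$, friction factor $\lambda_i>0$, height difference $\Delta h_i$, and $n_i\ge2$ spatial grid points with step $\Delta x_i>0$. Its unknowns are the temperatures $T_{i,1}(t),\dots,T_{i,n_i}(t)$ (left to right end), the velocity $v_i(t)$ and the end pressures $p_i(t,0),p_i(t,L_i)$. Set $x_1=(T_{i,j})_{1\le i\le N,\,2\le j\le n_i}$, $x_2=(v_i)_{1\le i\le N}$, $y=\big((T_{i,1})_{1\le i\le N},(p_i(\cdot,0),p_i(\cdot,L_i))_{1\le i\le N}\big)\in\mathbb R^{3N}$. In this reduced DAE the differential variable is $x_1$ and the algebraic variables are $(x_2,y)$. Constants: $\rho,c_p,k>0$, gravitational acceleration $g$, $T_{ext},T_{out}\in\mathbb R$. For an interior node $j$, $\sigma_j$ is the set of pipes entering $j$ and $\Sigma_j$ the set of pipes leaving $j$. The given functions of $t$ (below: $Q_k$, $T_{in}$, $p_{in}$, $p_{ret}$), on an open interval $I$, are sufficiently smooth. Equations. (i) $\dot x_1=f_1$: $\dot T_{i,j}=-\frac{v_i}{\Delta x_i}(T_{i,j}-T_{i,j-1})-\frac{4k}{c_p d_i\rho}(T_{i,j}-T_{ext})$ for $1\le i\le N$, $2\le j\le n_i$. (ii) $0=f_2$: $0=-\Big(\frac{p_i(t,L_i)-p_i(t,0)}{L_i\rho}+\frac{\lambda_i}{2d_i}v_i^2+g\frac{\Delta h_i}{L_i}\Big)$ for $1\le i\le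 N$. (iii) $0=g_1$ collects: pressure continuity at every interior node $j$ (all pressures at the pipe ends meeting at $j$ coincide, imposed by $|\sigma_j|+|\Sigma_j|-1$ equations); perfect mixing, $T_{i,1}=T_{l,1}$ for all $i,l\in\Sigma_j$ (imposed by $|\Sigma_j|-1$ equations); energy conservation $\sum_{i\in\sigma_j}c_pA_i\rho v_iT_{i,n_i}=\sum_{i\in\Sigma_j}c_pA_i\rho v_iT_{i,1}$ at every interior node $j$; the boundary conditions $T_{1,1}(t)=T_{in}(t)$, $p_1(t,0)=p_{in}(t)$, $p_N(t,L_N)=p_{ret}(t)$; and $T_{l,1}=T_{out}$ for every pipe $e_l$ leaving the supply node after a consumer. (iv) $0=g_2$ collects: mass conservation $\sum_{i\in\sigma_j}A_i\rho v_i=\sum_{i\in\Sigma_j}A_i\rho v_i$ at every interior node $j$; and, for every consumer $k$ located after pipe $e_i$ and before pipe $e_l$, $\rho v_i=\rho v_l$ and $Q_k(t)=c_pA_i\rho v_i(T_{i,n_i}-T_{out})$, where $Q_k$ is the given power demand of consumer $k$. Differentiation index: for a DAE $F(t,z,z')=0$ with a locally unique solution and $F$ sufficiently often continuously differentiable near the solution, it is the smallest $m$ such that $F=0,\frac{\mathrm dF}{\mathrm dt}=0,\dots,\frac{\mathrm d^mF}{\mathrm dt^m}=0$ can be rewritten as $z'=\phi(t,z)$; here $z=(x_1,x_2,y)$. For a semi-explicit DAE, index $1$ holds if the Jacobian of the algebraic equations with respect to the algebraic variables is regular in a neighborhood of the solution. *)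

(* Defs.v *)
From mathcomp Require Import all_boot all_order all_algebra.
From mathcomp Require Import all_classical all_reals all_analysis.

Set Implicit Arguments.
Unset Strict Implicit.
Unset Printing Implicit Defensive.

Import Order.TTheory GRing.Theory Num.Theory.
Import numFieldNormedType.Exports.

Local Open Scope ring_scope.

(* [Cn k U f]: f is k times continuously differentiable on the open set U.
   All uses are in finite dimension, where iterated directional derivatives
   are enough. *)
Fixpoint Cn (R : realType) (E : normedModType R) (k : nat) (U : set E)
    (f : E -> R) : Prop :=
  match k with
  | 0 => forall x, U x -> {for x, continuous f}
  | k'.+1 => (forall x, U x -> differentiable f x) /\
             forall v : E, Cn k' U (fun x => 'D_v f x)
  end.

Section DifferentiationIndex.
Variables (R : realType) (V : normedModType R) (E : Type).

(* One scalar equation is F e t z z' = 0; [e : E] runs over the equations. *)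
Variable F : E -> R -> V -> V -> R.

(* In a jet [w], w k stands for the k-th derivative of z. For a differentiable G
   depending on finitely many w k, this is
   dG/dt = G_t + sum_k G_(w k) (w k.+1),
   the derivative of G in the direction (1, w 1, w 2, ...). *)
Definition total_derivative (G : R -> (nat -> V) -> R) :
    R -> (nat -> V) -> R :=
  fun t w => derive1 (fun s : R => G (t + s) (fun k => w k + s *: w k.+1)) 0.

Definition derivative_array (m : nat) (t : R) (w : nat -> V) : Prop :=
  forall (k : nat) (e : E), (k <= m)%N ->
    iter k total_derivative (fun t w => F e t (w 0%N) (w 1%N)) t w = 0.

(* U is a neighbourhood in (t, z)-space of the graph of z over I. *)
Definition nbhd_of_solution (I : set R) (z : R -> V) (U : set (R * V)) : Prop :=
  open U /\ forall t, I t -> U (t, z t).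

(* The equations F = 0, dF/dt = 0, ..., d^m F/dt^m = 0 can be rewritten as
   z' = phi(t, z) near the solution z. *)
Definition determines_derivative (I : set R) (z : R -> V) (m : nat) : Prop :=
  exists (U : set (R * V)) (phi : R * V -> V),
    [/\ nbhd_of_solution I z U,
        forall x, U x -> {for x, continuous phi} &
        forall t w, U (t, w 0%N) -> derivative_array m t w ->
          w 1%N = phi (t, w 0%N)].

Definition differentiation_index (I : set R) (z : R -> V) (m : nat) : Prop :=
  [/\ exists U : set (R * V), nbhd_of_solution I z U /\
        forall e : E, Cn m (fun x : R * V * V => U x.1)
                           (fun x : R * V * V => F e x.1.1 x.1.2 x.2),
      determines_derivative I z m &
      forall m' : nat, (m' < m)%N -> ~ determines_derivative I z m'].

End DifferentiationIndex.

(* The subgraph of the digraph (T, r) induced on A is a polytree. A simple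
   undirected cycle has length at least 3: x - y - x is not a cycle of the
   underlying undirected graph. Loops and antiparallel edges are excluded by
   directed acyclicity. *)
Section Polytree.
Variables (T : finType) (r : rel T) (A : {set T}).

Definition induced : rel T := [rel x y | [&& x \in A, y \in A & r x y]].

Definition underlying : rel T := [rel x y | induced x y || induced y x].

Definition directed_acyclic : Prop :=
  forall c : seq T, cycle induced c -> c = [::].

Definition undirected_tree : Prop :=
  [/\ exists x, x \in A,
      {in A &, forall x y, connect underlying x y} &
      forall c : seq T, ucycle underlying c -> (size c < 3)%N].

Definition polytree : Prop := directed_acyclic /\ undirected_tree.

End Polytree.

(* The nodes outside [supply_net] form the return network. The pipes e_1, ...,
   e_N are 'I_npred.+1, with e_1 = ord0 and e_N = ord_max. The power plant is
   located after e_N and before e_1; consumer k is located after the pipe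
   [before k] and before the pipe [after k]. Pipe i has n_i = (ngrid i).+2 grid
   points. *)
Record network (R : realType) := Network {
  node : finType;
  npred : nat;
  source : 'I_npred.+1 -> node;
  target : 'I_npred.+1 -> node;
  supply : {set node};
  demand : {set node};
  supply_net : {set node};
  nconsumers : nat;
  before : 'I_nconsumers -> 'I_npred.+1;
  after : 'I_nconsumers -> 'I_npred.+1;
  len : 'I_npred.+1 -> R;
  diam : 'I_npred.+1 -> R;
  friction : 'I_npred.+1 -> R;
  dheight : 'I_npred.+1 -> R;
  ngrid : 'I_npred.+1 -> nat;
  dx : 'I_npred.+1 -> R;
  rho : R;
  heatcap : R;
  heatcoef : R;
  grav : R;
  Text : R;
  Tout : R
}.

Section Network.
Variables (R : realType) (G : network R).

Local Notation pipe := 'I_(npred G).+1.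

Definition return_net : {set node G} := ~: supply_net G.

Definition interior : {set node G} := ~: (supply G :|: demand G).

Definition entering (j : node G) : {set pipe} := [set i | target i == j].
Definition leaving (j : node G) : {set pipe} := [set i | source i == j].

Definition edge : rel (node G) :=
  [rel u w | [exists i : pipe, (source i == u) && (target i == w)]].

Record topology_ok : Prop := TopologyOk {
  no_parallel_pipes : injective (fun i : pipe => (source i, target i));
  supply_demand_disjoint : [disjoint supply G & demand G];
  supply_pipe : forall j, j \in supply G ->
    #|leaving j| = 1%N /\ #|entering j| = 0%N;
  demand_pipe : forall j, j \in demand G ->
    #|entering j| = 1%N /\ #|leaving j| = 0%N;
  interior_pipes : forall j, j \in interior ->
    (2 <= #|entering j| + #|leaving j|)%N;
  card_supply : #|supply G| = (nconsumers G).+1;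
  card_demand : #|demand G| = (nconsumers G).+1;
  before_inj : injective (@before R G);
  after_inj : injective (@after R G);
  pipes_separated : forall i : pipe,
    (source i \in supply_net G) = (target i \in supply_net G);
  plant_supply : source (ord0 : pipe) \in supply G :&: supply_net G;
  plant_demand : target (ord_max : pipe) \in demand G :&: return_net;
  consumer_demand : forall k : 'I_(nconsumers G),
    target (before k) \in demand G :&: supply_net G;
  consumer_supply : forall k : 'I_(nconsumers G),
    source (after k) \in supply G :&: return_net
}.

Record parameters_ok : Prop := ParametersOk {
  len_gt0 : forall i : pipe, 0 < len i;
  diam_gt0 : forall i : pipe, 0 < diam i;
  friction_gt0 : forall i : pipe, 0 < friction i;
  dx_gt0 : forall i : pipe, 0 < dx i;
  rho_gt0 : 0 < rho G;
  heatcap_gt0 : 0 < heatcap G;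
  heatcoef_gt0 : 0 < heatcoef G
}.

Definition demand_nodes_before_units : Prop :=
  forall j, j \in demand G ->
    j = target (ord_max : pipe) \/ exists k, j = target (before k).

(* [Tagged _ j : gridpt], at pipe i, indexes the temperature T_{i, j+2}. *)
Definition gridpt := {i : pipe & 'I_(ngrid i).+1}.

Definition X1 := 'rV[R]_#|{: gridpt}|.
Definition X2 := 'rV[R]_(npred G).+1.
(* left-end temperatures T_{i,1}, then p_i(t,0), then p_i(t,L_i) *)
Definition Y :=
  ('rV[R]_(npred G).+1 * 'rV[R]_(npred G).+1 * 'rV[R]_(npred G).+1)%type.

Implicit Types (t : R) (y : Y) (i : pipe).

Definition vel (x2 : X2) i : R := x2 0 i.
Definition Tleft y i : R := y.1.1 0 i.
Definition pleft y i : R := y.1.2 0 i.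
Definition pright y i : R := y.2 0 i.

Definition Tgrid (x1 : X1) (a : gridpt) : R := x1 0 (enum_rank a).

Definition Tright (x1 : X1) i : R :=
  Tgrid x1 (Tagged (fun i => 'I_(ngrid i).+1) (ord_max : 'I_(ngrid i).+1)).

(* T_{i, j+1} for j : 'I_(n_i) *)
Definition temp (x1 : X1) y i (j : 'I_(ngrid i).+2) : R :=
  if unlift ord0 j is Some j' then
    Tgrid x1 (Tagged (fun i => 'I_(ngrid i).+1) j')
  else Tleft y i.

Definition area i : R := pi * (diam i / 2) ^+ 2.

(* A pipe end is (i, true) for the right end of i, (i, false) for the left. *)
Definition pressure y (e : pipe * bool) : R :=
  if e.2 then pright y e.1 else pleft y e.1.

Definition ends_at (j : node G) : seq (pipe * bool) :=
  [seq (i, true) | i <- enum (entering j)] ++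
  [seq (i, false) | i <- enum (leaving j)].

Variables (Q : 'I_(nconsumers G) -> R -> R) (Tin pin pret : R -> R).

Definition f1 (a : gridpt) t (x1 : X1) (x2 : X2) y : R :=
  let i := tag a in
  let j := tagged a in
  let Tj := temp x1 y (lift ord0 j) in
  let Tjpred := temp x1 y (widen_ord (leqnSn _) j) in
  - (vel x2 i / dx i) * (Tj - Tjpred)
  - (4 * heatcoef G / (heatcap G * diam i * rho G)) * (Tj - Text G).

Definition f2 i t (x1 : X1) (x2 : X2) y : R :=
  - ((pright y i - pleft y i) / (len i * rho G)
     + friction i / (2 * diam i) * vel x2 i ^+ 2
     + grav G * (dheight i / len i)).

(* Equality of n quantities is imposed by n.-1 equations, comparing the first
   one to each of the others. *)
Inductive g1_eqn :=
| Pressure_continuity (j : node G) of j \in interior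
    & 'I_(size (ends_at j)).-1
| Perfect_mixing (j : node G) of j \in interior & 'I_#|leaving j|.-1
| Energy_conservation (j : node G) of j \in interior
| Inlet_temperature
| Inlet_pressure
| Return_pressure
| Consumer_temperature of 'I_(nconsumers G).

Definition g1 (e : g1_eqn) t (x1 : X1) (x2 : X2) y : R :=
  match e with
  | Pressure_continuity j _ k =>
      let p := nth (ord0, false) (ends_at j) in
      pressure y (p 0%N) - pressure y (p k.+1)
  | Perfect_mixing j _ k =>
      let l := nth ord0 (enum (leaving j)) in
      Tleft y (l 0%N) - Tleft y (l k.+1)
  | Energy_conservation j _ =>
      \sum_(i in entering j) heatcap G * area i * rho G * vel x2 i * Tright x1 i
      - \sum_(i in leaving j) heatcap G * area i * rho G * vel x2 i * Tleft y i
  | Inlet_temperature => Tleft y ord0 - Tin t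
  | Inlet_pressure => pleft y ord0 - pin t
  | Return_pressure => pright y ord_max - pret t
  | Consumer_temperature k => Tleft y (after k) - Tout G
  end.

Inductive g2_eqn :=
| Mass_conservation (j : node G) of j \in interior
| Consumer_flow of 'I_(nconsumers G)
| Consumer_power of 'I_(nconsumers G).

Definition g2 (e : g2_eqn) t (x1 : X1) (x2 : X2) : R :=
  match e with
  | Mass_conservation j _ =>
      \sum_(i in entering j) area i * rho G * vel x2 i
      - \sum_(i in leaving j) area i * rho G * vel x2 i
  | Consumer_flow k => rho G * vel x2 (before k) - rho G * vel x2 (after k)
  | Consumer_power k =>
      Q k t - heatcap G * area (before k) * rho G * vel x2 (before k)
              * (Tright x1 (before k) - Tout G)
  end.

Definition state : Type := (X1 * X2 * Y)%type.

Inductive dae_eqn :=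
| Eqn_f1 of gridpt | Eqn_f2 of pipe | Eqn_g1 of g1_eqn | Eqn_g2 of g2_eqn.

Definition dae (e : dae_eqn) t (z z' : state) : R :=
  let: (x1, x2, y) := z in
  match e with
  | Eqn_f1 a => Tgrid z'.1.1 a - f1 a t x1 x2 y
  | Eqn_f2 i => f2 i t x1 x2 y
  | Eqn_g1 e => g1 e t x1 x2 y
  | Eqn_g2 e => g2 e t x1 x2
  end.

(* As usual for semi-explicit systems, only the differential variable x1 is
   required to be differentiable. *)
Definition dae_solution (I : set R) (x1 : R -> X1) (x2 : R -> X2)
    (y : R -> Y) : Prop :=
  forall t, I t ->
  [/\ forall a, is_derive t (1 : R) (fun s => Tgrid (x1 s) a)
                  (f1 a t (x1 t) (x2 t) (y t)),
      forall i, f2 i t (x1 t) (x2 t) (y t) = 0,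
      forall e, g1 e t (x1 t) (x2 t) (y t) = 0 &
      forall e, g2 e t (x1 t) (x2 t) = 0].

End Network.

(* Main.v *)
From HB Require Import structures.
Require Import Defs.
From mathcomp Require Import all_boot all_order all_algebra.
From mathcomp Require Import all_classical all_reals all_analysis.
From mathcomp Require Import ring.

(** Positivity. A consumer with a positive power demand draws a positive flow,
    so the velocity is positive in every demand pipe of the supply network and
    in every supply pipe of the return network. Removing a pipe from a polytree
    leaves two branches, and one of them avoids the node of the power plant.
    The flows on the boundary of that branch are positive and all point the
    same way, so conservation of mass and nonnegativity of the velocities force
    a positive flow through the removed pipe. The argument is run as an
    induction on branches ([branch_ind], [positive_flow]), which also shows that
    every branch contains a boundary node.

    Index at most one. At a solution the linearization of the algebraic
    equations in the algebraic variables is injective ([jacobian_kernel]), and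
    this is read off in three stages. The power equations have the nonzero
    coefficient [Tright - Tout], so the perturbation of the velocity vanishes at
    the consumers, and by conservation of mass everywhere ([zero_flow]). Then
    the mixing and energy equations at an interior node give the perturbation of
    the common temperature of the leaving pipes with the coefficient
    [\sum c_p A rho v], which is positive because all velocities are. Finally
    the momentum equations and the continuity of the pressure carry the
    perturbation zero from the power plant through each of the two connected
    networks ([pressures_eq0]). Differentiating the algebraic equations once
    gives a linear system for the derivative of the algebraic variables. Its
    matrix [J] has trivial kernel, so [J J^T] is invertible and the normal
    equations express that derivative continuously near the solution
    ([semi_explicit_determined]); the number of equations never has to be
    compared with the number of unknowns.

    Index not zero. Without differentiation the equations leave the derivative
    of the algebraic variables completely free. *)

Set Implicit Arguments.
Unset Strict Implicit.
Unset Printing Implicit Defensive.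

Import Order.TTheory GRing.Theory Num.Theory.
Import numFieldNormedType.Exports.
Local Open Scope classical_set_scope.
Local Open Scope ring_scope.

(** * Branches of a polytree *)

Section Branches.
Variables (R : realType) (G : network R) (A : {set node G}).
Hypothesis pipes_simple :
  injective (fun i : 'I_(npred G).+1 => (source i, target i)).
Hypothesis A_closed : forall i : 'I_(npred G).+1,
  (source i \in A) = (target i \in A).
Hypothesis A_polytree : polytree (@edge R G) A.

Local Notation pipe := 'I_(npred G).+1.
Local Notation und := (underlying (@edge R G) A).

Definition pipe_end (i : pipe) (b : bool) : node G :=
  if b then target i else source i.

(** Both orientations of the pipe are removed. *)
Definition und_without (i : pipe) : rel (node G) :=
  [rel x y | und x y && [forall b, (x, y) != (pipe_end i b, pipe_end i (~~ b))]].

(** The connected component, once [i] is removed, of the end [b] of [i]. *)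
Definition branch (i : pipe) (b : bool) : {set node G} :=
  [set x | connect (und_without i) (pipe_end i b) x].

Lemma pipe_end_net i b b' : (pipe_end i b \in A) = (pipe_end i b' \in A).
Proof. by case: b b' => [] []; rewrite /= ?A_closed. Qed.

Lemma und_pipe i b : pipe_end i b \in A ->
  und (pipe_end i b) (pipe_end i (~~ b)).
Proof.
move=> iA; have sA : source i \in A by rewrite -(pipe_end_net i b false).
have tA : target i \in A by rewrite -A_closed.
have e : edge (source i) (target i) by apply/existsP; exists i; rewrite !eqxx.
by case: b {iA} => /=; rewrite /underlying /Defs.induced /= sA tA e ?orbT.
Qed.

Lemma und_pipeP x y : und x y ->
  exists i b, x = pipe_end i b /\ y = pipe_end i (~~ b).
Proof.
by case/orP=> /and3P[_ _ /existsP[i /andP[/eqP<- /eqP<-]]];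
  [exists i, false | exists i, true].
Qed.

Lemma und_sym : symmetric und.
Proof. by move=> x y; rewrite /underlying /= orbC. Qed.

Lemma und_without_sym i : symmetric (und_without i).
Proof.
move=> x y; congr andb; first exact: und_sym.
apply/forallP/forallP => h b; have := h (~~ b);
  by rewrite !xpair_eqE negbK andbC.
Qed.

Lemma no_loop (i : pipe) b : pipe_end i b \in A ->
  pipe_end i b != pipe_end i (~~ b).
Proof.
move=> iA; apply/eqP => e; have [acyc _] := A_polytree.
have := acyc [:: pipe_end i b]; rewrite /= /Defs.induced /= andbT iA /=.
suff -> : edge (pipe_end i b) (pipe_end i b) by move=> /(_ isT).
by apply/existsP; exists i; case: b e {iA} => /= ->; rewrite !eqxx.
Qed.

(** Parallel pipes are excluded by hypothesis and antiparallel ones by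
    acyclicity, so a pipe of the net is determined by its unordered pair of
    ends. *)
Lemma pipe_ends_inj i i' b b' : pipe_end i b \in A ->
  pipe_end i b = pipe_end i' b' -> pipe_end i (~~ b) = pipe_end i' (~~ b') ->
  i = i' /\ b = b'.
Proof.
move=> iA e1 e2; have [acyc _] := A_polytree.
have sA : source i \in A by rewrite -(pipe_end_net i b false).
have tA : target i \in A by rewrite -A_closed.
have [bb|bb] := eqVneq b b'.
  by subst b'; split => //; apply: pipes_simple; case: b e1 e2 {iA} => /= -> ->.
have ed k : edge (source k) (target k) by apply/existsP; exists k; rewrite !eqxx.
have [e3 e4] : source i = target i' /\ target i = source i'.
  by case: b b' bb e1 e2 {iA} => [] [].
have := acyc [:: source i; target i].
by rewrite /= /Defs.induced /= sA tA ed e3 e4 ed => /(_ isT).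
Qed.

(** A path joining the two ends of a pipe without using it would close up to a
    cycle of length at least three. *)
Lemma pipe_bridge i b : pipe_end i b \in A ->
  ~~ connect (und_without i) (pipe_end i b) (pipe_end i (~~ b)).
Proof.
move=> iA; have [acyc [_ _ cyc]] := A_polytree.
apply/negP => /connectP[p pp e].
have := no_loop iA; have := und_pipe iA; move: pp e.
set s := pipe_end i b; set t := pipe_end i (~~ b) => pp e.
case/shortenP: pp e => q pq uq _ e st nst.
case: q pq uq e => [|x [|y q]] pq uq e.
- by rewrite e eqxx in nst.
- move: pq; rewrite /= -[x]e andbT => /andP[_ /forallP/(_ b)].
  by rewrite eqxx.
suff /cyc : ucycle und [:: s, x, y & q] by [].
apply/andP; split; last exact: uq.
rewrite /cycle rcons_path; apply/andP; split.
  have sub : subrel (und_without i) und by move=> u v /andP[].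
  by apply: (path.sub_path sub).
by rewrite und_sym [last _ _](esym e).
Qed.

Lemma head_branch i b : pipe_end i b \in branch i b.
Proof. by rewrite inE connect0. Qed.

Lemma tail_notin_branch i b : pipe_end i b \in A ->
  pipe_end i (~~ b) \notin branch i b.
Proof. by move=> iA; rewrite inE pipe_bridge. Qed.

(** The end [b] of [i] separates the rest of its branch from the branches of
    the other pipes issuing from it, so that a path in one of these never meets
    the pipe [i]. *)
Lemma branch_sub i b i' b' : pipe_end i b \in A -> i' != i ->
  pipe_end i' (~~ b') = pipe_end i b -> branch i' b' \proper branch i b.
Proof.
move=> iA ii' tc; have i'A : pipe_end i' b' \in A.
  by rewrite (pipe_end_net _ _ (~~ b')) tc.
have cN := tail_notin_branch i'A.
apply/properP; split; last first.
  by exists (pipe_end i b); rewrite ?head_branch // -tc.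
have step x y : x != pipe_end i b -> y != pipe_end i b -> und x y ->
    und_without i x y.
  move=> xc yc xy; apply/andP; split=> //; apply/forallP => d.
  by rewrite xpair_eqE; case: d b xc yc {iA tc} => [] [] /= xc yc;
    rewrite ?(negbTE xc) ?(negbTE yc) ?andbF.
apply/fintype.subsetP => x; rewrite !inE => /connectP[p pp ->].
have : pipe_end i' b' \in branch i' b' := head_branch _ _.
have : connect (und_without i) (pipe_end i b) (pipe_end i' b').
  apply: connect1; have := und_pipe (i := i') (b := ~~ b').
  rewrite negbK tc => /(_ iA) e; apply/andP; split=> //.
  apply/forallP => d; apply/negP.
  rewrite xpair_eqE => /andP[/eqP e1 /eqP e2].
  have [ii _] : i' = i /\ ~~ b' = d.
    by apply: pipe_ends_inj; rewrite ?tc ?negbK.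
  by rewrite ii eqxx in ii'.
elim: p (pipe_end i' b') pp => [|y p IH] u //= /andP[uy pp] cu u_in.
have y_in : y \in branch i' b'.
  by move: u_in; rewrite !inE => /connect_trans; apply; apply: connect1.
apply: IH => //; apply: (connect_trans cu); apply: connect1.
have notc v : v \in branch i' b' -> v != pipe_end i b.
  by move=> vb; apply: contraNneq cN => cv; rewrite tc -cv.
by apply: step; rewrite ?notc //; case/andP: uy.
Qed.

(** Induction along a tree from its leaves towards the root. The branches of the
    other pipes issuing from the end [b] of [i] are strictly smaller than the
    branch of [(i, b)], by [branch_sub], and still avoid the root. *)
Lemma branch_ind (root : node G) (P : pipe -> bool -> Prop) :
  (forall i b, pipe_end i b \in A -> pipe_end i b != root ->
     (forall i' b', i' != i -> pipe_end i' (~~ b') = pipe_end i b -> P i' b') ->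
     P i b) ->
  forall i b, pipe_end i b \in A -> root \notin branch i b -> P i b.
Proof.
move=> Pstep i b; move: {2}_.+1 (ltnSn #|branch i b|) => n.
elim: n i b => // n IH i b; rewrite ltnS => bn iA rN.
apply: Pstep => //.
  by apply: contraNneq rN => <-; rewrite head_branch.
move=> i' b' ii' tc; have /properP[sub _] := branch_sub iA ii' tc.
apply: IH.
- by apply: leq_trans bn; apply: proper_card; exact: branch_sub.
- by rewrite (pipe_end_net _ _ (~~ b')) tc.
- by apply: contraNN rN; apply/fintype.subsetP.
Qed.

(** The two ends of a pipe lie in different components once the pipe is
    removed, hence the root is missing from one of them. *)
Lemma rootless_branch (root : node G) i : source i \in A ->
  exists b, root \notin branch i b.
Proof.
move=> sA; have [h|] := boolP (root \in branch i false); last by exists false.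
exists true; apply/negP; move: h; rewrite !inE /= => h1 h2.
have := pipe_bridge (i := i) (b := false) sA; case/negP.
by apply: (connect_trans h1); rewrite (sym_connect_sym (@und_without_sym i)).
Qed.
End Branches.

(** * Flows in a polytree *)

Section Flows.
Variables (R : realType) (G : network R) (A : {set node G}).
Hypothesis pipes_simple :
  injective (fun i : 'I_(npred G).+1 => (source i, target i)).
Hypothesis A_closed : forall i : 'I_(npred G).+1,
  (source i \in A) = (target i \in A).
Hypothesis A_polytree : polytree (@edge R G) A.

Local Notation pipe := 'I_(npred G).+1.

Variables (root : node G) (w : pipe -> R).
Hypothesis w_conserved : forall j, j \in Defs.interior G ->
  \sum_(i in entering j) w i = \sum_(i in leaving j) w i.

Let conserved i b : pipe_end i b \in Defs.interior G ->
  \sum_(k | pipe_end k b == pipe_end i b) w k =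
  \sum_(k | pipe_end k (~~ b) == pipe_end i b) w k.
Proof.
move=> /w_conserved.
rewrite (eq_bigl (fun k => pipe_end k true == pipe_end i b)); last first.
  by move=> k; rewrite inE.
rewrite [RHS](eq_bigl (fun k => pipe_end k false == pipe_end i b)); last first.
  by move=> k; rewrite inE.
by case: b.
Qed.

(** At an interior node all pipes but the one leading to the root carry no flow,
    by induction, and conservation of mass extends this to the last one. *)
Lemma zero_flow :
  (forall i b, pipe_end i b \in A -> pipe_end i b != root ->
     pipe_end i b \notin Defs.interior G -> w i = 0) ->
  forall i, source i \in A -> w i = 0.
Proof.
move=> w_boundary i sA.
have [b rN] := rootless_branch A_closed A_polytree root sA.
have iA : pipe_end i b \in A by rewrite (pipe_end_net A_closed _ _ false).
pose P (i : pipe) (b : bool) := w i = 0.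
apply: (branch_ind pipes_simple A_closed A_polytree (root := root) (P := P)) iA rN.
move=> {sA} {}i {}b iA nr IH; rewrite /P.
have [inn|] := boolP (pipe_end i b \in Defs.interior G); last exact: w_boundary.
have := conserved inn.
rewrite (bigD1 i) //= big1 => [|k /andP[/eqP kc ki]]; last first.
  by apply: (IH k (~~ b)) => //; rewrite negbK.
rewrite big1 ?addr0 // => k /eqP kc.
apply: (IH k b) => //; apply: contra_neq (no_loop A_polytree iA) => ki.
by rewrite -kc ki.
Qed.

(** At an interior node the pipes leading away from the root touch the node with
    their ends [~~ b0] and carry positive flows, by induction. Conservation of
    mass then forces the remaining pipe to touch the node with its end [b0] and
    to carry a positive flow. *)
Lemma positive_flow (b0 : bool) :
  (forall i, 0 <= w i) ->
  (forall j, j \in Defs.interior G -> (2 <= #|entering j| + #|leaving j|)%N) ->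
  (forall i b, pipe_end i b \in A -> pipe_end i b != root ->
     pipe_end i b \notin Defs.interior G -> b = b0 /\ 0 < w i) ->
  forall i, source i \in A -> 0 < w i.
Proof.
move=> w_ge0 two_pipes w_boundary i sA.
have [b rN] := rootless_branch A_closed A_polytree root sA.
have iA : pipe_end i b \in A by rewrite (pipe_end_net A_closed _ _ false).
pose P (i : pipe) (b : bool) := b = b0 /\ 0 < w i.
suff [] : P i b by [].
apply: (branch_ind pipes_simple A_closed A_polytree (root := root) (P := P)) iA rN.
move=> {sA} {}i {}b iA nr IH; rewrite /P.
have [inn|] := boolP (pipe_end i b \in Defs.interior G); last exact: w_boundary.
have loopless := no_loop A_polytree iA.
have [k [ki [d kc]]] : exists k, k != i /\ exists d, pipe_end k (~~ d) = pipe_end i b.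
  have := two_pipes _ inn; set j := pipe_end i b.
  have disj : entering j :&: leaving j = finset.set0.
    apply/finset.setP => k; rewrite !inE; apply/negP => /andP[/eqP e1 /eqP e2].
    have := no_loop A_polytree (i := k) (b := true).
    by rewrite /= e1 e2 eqxx => /(_ iA).
  rewrite -cardsUI disj cards0 addn0 (cardsD1 i) => le2.
  have : (0 < #|(entering j :|: leaving j) :\ i|)%N.
    by move: le2; case: (i \in _) => //= /ltnW.
  case/card_gt0P => k; rewrite !inE => /andP[ki /orP[]/eqP e].
    by exists k; split => //; exists false.
  by exists k; split => //; exists true.
have [kb0 wk] := IH k d ki kc.
have cons := conserved inn.
(* All other pipes at the node touch it with their end [~~ b0]. *)
have [bb|bb] := eqVneq b b0.
  split=> //; move: cons; rewrite (bigD1 i) //= big1 ?addr0 => [->|l /andP[/eqP lc li]].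
    rewrite (bigD1 k) /=; last by rewrite [in X in X == _]bb -kb0 kc.
    by rewrite ltr_wpDr // sumr_ge0.
  have [] : ~~ b = b0 /\ 0 < w l by apply: (IH l (~~ b)) => //; rewrite negbK.
  by rewrite bb => /eqP; case: (b0).
(* Otherwise all pipes touch the node with the same end: nothing balances the
   positive flow of [k]. *)
exfalso; move: cons; rewrite [RHS]big1 => [|l /eqP lc].
  apply/eqP; rewrite gt_eqF // (bigD1 i) //= (bigD1 k) /=; last first.
    have eb : b = ~~ b0 by move: bb; case: (b); case: (b0).
    by rewrite ki andbT [in X in X == _]eb -kb0 kc.
  rewrite addrCA ltr_wpDr // addr_ge0 // sumr_ge0 //.
have [] : b = b0 /\ 0 < w l; last by move=> e; rewrite e eqxx in bb.
apply: (IH l b) => //; apply: contra_neq loopless => li.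
by rewrite -lc li.
Qed.
End Flows.

(** * Continuously differentiable functions *)

Section C1Functions.
Variables (R : realType) (E : normedModType R) (U : set E).
Hypothesis U_open : open U.
Implicit Types f g : E -> R.

Lemma C1_differentiable f x : Cn 1 U f -> U x -> differentiable f x.
Proof. by move=> Cf Ux; exact: (proj1 Cf x Ux). Qed.

Lemma C1_continuous f x : Cn 1 U f -> U x -> {for x, continuous f}.
Proof.
by move=> Cf Ux; exact: differentiable_continuous (C1_differentiable Cf Ux).
Qed.

Lemma C1_derive_continuous f v x : Cn 1 U f -> U x ->
  {for x, continuous (fun y => 'D_v f y)}.
Proof. by move=> Cf Ux; exact: (proj2 Cf v x Ux). Qed.

Lemma C1_derivable f x v : Cn 1 U f -> U x -> derivable f x v.
Proof.
by move=> Cf Ux; exact: diff_derivable (C1_differentiable Cf Ux).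
Qed.

Lemma continuous_eq_on (W : topologicalType) (f g : E -> W) x :
  (forall y, U y -> g y = f y) -> U x ->
  {for x, continuous g} -> {for x, continuous f}.
Proof.
move=> gf Ux cg; rewrite /prop_for /continuous_at -(gf x Ux).
apply: cvg_trans cg; apply: near_eq_cvg.
by near=> y; rewrite gf //; near: y; apply: open_nbhs_nbhs.
Unshelve. all: by end_near. Qed.

Lemma C1_cst (c : R) : Cn 1 U (fun=> c).
Proof.
split=> [x _|v x _]; first exact: differentiable_cst.
rewrite (_ : (fun y => 'D_v _ y) = cst 0); first exact: cst_continuous.
by apply/funext => y; rewrite derive_cst.
Qed.

Lemma C1D f g : Cn 1 U f -> Cn 1 U g -> Cn 1 U (fun x => f x + g x).
Proof.
move=> Cf Cg; split=> [x Ux|v x Ux].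
  exact: differentiableD (C1_differentiable Cf Ux) (C1_differentiable Cg Ux).
apply: (continuous_eq_on (f := fun x => 'D_v (f + g) x)
  (g := fun y => 'D_v f y + 'D_v g y) _ Ux); last first.
  by apply: continuousD; exact: C1_derive_continuous.
by move=> y Uy; rewrite deriveD //; exact: C1_derivable.
Qed.

Lemma C1M f g : Cn 1 U f -> Cn 1 U g -> Cn 1 U (fun x => f x * g x).
Proof.
move=> Cf Cg; split=> [x Ux|v x Ux].
  exact: differentiableM (C1_differentiable Cf Ux) (C1_differentiable Cg Ux).
apply: (continuous_eq_on (f := fun x => 'D_v (f * g) x)
  (g := fun y => f y * 'D_v g y + g y * 'D_v f y) _ Ux).
  by move=> y Uy; rewrite deriveM //; exact: C1_derivable.
apply: continuousD; apply: continuousM.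
- exact: C1_continuous.
- exact: C1_derive_continuous.
- exact: C1_continuous.
- exact: C1_derive_continuous.
Qed.

Lemma C1N f : Cn 1 U f -> Cn 1 U (fun x => - f x).
Proof.
move=> Cf; rewrite (_ : (fun x => _) = (fun x => -1 * f x)).
  exact: (C1M (C1_cst (-1)) Cf).
by apply/funext => x; rewrite mulN1r.
Qed.

Lemma C1B f g : Cn 1 U f -> Cn 1 U g -> Cn 1 U (fun x => f x - g x).
Proof. by move=> Cf Cg; exact: (C1D Cf (C1N Cg)). Qed.

Lemma C1X f n : Cn 1 U f -> Cn 1 U (fun x => f x ^+ n).
Proof.
move=> Cf; elim: n => [|n IH]; first exact: C1_cst.
rewrite (_ : (fun x => _) = (fun x => f x * f x ^+ n)); first exact: (C1M Cf IH).
by apply/funext => x; rewrite exprS.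
Qed.

Lemma C1_sum (T : Type) (r : seq T) (P : pred T) (F : T -> E -> R) :
  (forall i, Cn 1 U (F i)) -> Cn 1 U (fun x => \sum_(i <- r | P i) F i x).
Proof.
move=> CF; elim: r => [|i r IH].
  rewrite (_ : (fun x => _) = (fun=> 0)); first exact: C1_cst.
  by apply/funext => x; rewrite big_nil.
rewrite (_ : (fun x => _) = (fun x => (if P i then F i x else 0) +
  \sum_(i <- r | P i) F i x)).
  by apply: C1D IH; case: (P i); [exact: CF|exact: C1_cst].
by apply/funext => x; rewrite big_cons; case: ifP => // _; rewrite add0r.
Qed.

Lemma C1_deriveD f x u v : Cn 1 U f -> U x -> 'D_(u + v) f x = 'D_u f x + 'D_v f x.
Proof. by move=> [df _] Ux; rewrite !deriveE ?raddfD //; exact: df. Qed.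

Lemma C1_deriveZ f x a u : Cn 1 U f -> U x -> 'D_(a *: u) f x = a * 'D_u f x.
Proof. by move=> [df _] Ux; rewrite !deriveE ?linearZ //; exact: df. Qed.

Lemma C1_derive_sum (T : Type) (r : seq T) (F : T -> E) f x :
  Cn 1 U f -> U x ->
  'D_(\sum_(i <- r) F i) f x = \sum_(i <- r) 'D_(F i) f x.
Proof.
move=> [df _] Ux; rewrite deriveE ?raddf_sum; last exact: df.
by apply: eq_bigr => i _; rewrite deriveE //; exact: df.
Qed.
End C1Functions.

Lemma C1_subset (R : realType) (E : normedModType R) (U U' : set E) (f : E -> R) :
  U' `<=` U -> Cn 1 U f -> Cn 1 U' f.
Proof. by move=> UU [df Cf]; split=> [x|v x] /UU; [exact: df|exact: Cf]. Qed.

(** Time-dependent data are given on an interval only: they become functions of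
    the whole state by pulling back along a projection [L]. *)
Lemma C1_comp_linear (R : realType) (E E' : normedModType R) (L : E -> E')
    (U : set E') (f : E' -> R) :
  linear L -> continuous L -> Cn 1 U f -> Cn 1 (L @^-1` U) (fun x => f (L x)).
Proof.
move=> Llin cL [df Cf].
pose L' : {linear E -> E'} := HB.pack L (GRing.isLinear.Build _ _ _ _ _ Llin).
split=> [x Ux|v x Ux].
  apply: (differentiable_comp (f := L)); last exact: df.
  by rewrite (_ : L = L') //; apply: linear_differentiable; exact: cL.
rewrite (_ : (fun y => _) = (fun y => 'D_(L v) f y) \o L).
  by apply: continuous_comp; [exact: cL|exact: Cf].
apply/funext => y /=; rewrite /derive.
rewrite (_ : (fun h => _) =
  (fun h : R => h^-1 *: (f (h *: L v + L y) - f (L y)))) //.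
by apply/funext => h; rewrite /= Llin.
Qed.

Lemma C1_id (R : realType) (U : set R) : Cn 1 U id.
Proof.
split=> [x _|v x _]; first by case: (is_diff_id x).
rewrite (_ : (fun y => 'D_v _ y) = cst v); first exact: cst_continuous.
by apply/funext => y; exact: derive_id.
Qed.

Lemma C1_linear (R : realType) (E : normedModType R) (L : E -> R) (U : set E) :
  linear L -> continuous L -> Cn 1 U L.
Proof.
move=> Llin cL; apply: (@C1_subset _ _ (L @^-1` setT)) => //.
exact: C1_comp_linear Llin cL (@C1_id R setT).
Qed.

(** * Least squares with continuous coefficients *)

Section LeastSquares.
Variable R : realFieldType.

(** If [u *m (J *m J^T) = 0], then the sum of the squares of the entries of
    [u *m J] vanishes. *)
Lemma gram_det_neq0 m p (J : 'M[R]_(m, p)) :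
  (forall u : 'rV_m, u *m J = 0 -> u = 0) -> \det (J *m J^T) != 0.
Proof.
move=> Jinj; apply/negP => /det0P[u u0 uJJ].
suff /Jinj uz : u *m J = 0 by rewrite uz eqxx in u0.
have : (u *m J *m (u *m J)^T) 0 0 = 0.
  by rewrite trmx_mul !mulmxA -(mulmxA u) uJJ mul0mx mxE.
rewrite mxE => /eqP; rewrite psumr_eq0 => [/allP h|k _]; last first.
  by rewrite [_^T _ _]mxE -expr2 sqr_ge0.
apply/rowP => k; have := h k (mem_index_enum _).
by rewrite [_^T _ _]mxE mulf_eq0 orbb => /eqP ->; rewrite mxE.
Qed.

(** The normal equations express the solution of an overdetermined system by a
    rational function of its coefficients. *)
Lemma least_squares m p (J : 'M[R]_(m, p)) (u : 'rV_m) (b : 'rV_p) :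
  \det (J *m J^T) != 0 -> u *m J = b ->
  u = (\det (J *m J^T))^-1 *: (b *m J^T *m \adj (J *m J^T)).
Proof.
move=> d0 <-; rewrite -(mulmxA u) -mulmxA mul_mx_adj mul_mx_scalar.
by rewrite scalerA mulVf // scale1r.
Qed.
End LeastSquares.

Section ContinuousMatrices.
Variables (R : realType) (T : topologicalType) (x : T).

Lemma continuous_at_sum (V : normedModType R) (I : Type) (r : seq I)
    (P : pred I) (F : I -> T -> V) :
  (forall i, {for x, continuous (F i)}) ->
  {for x, continuous (fun y => \sum_(i <- r | P i) F i y)}.
Proof.
by move=> cF; apply: (cvg_big (@add_continuous V)) => i _; exact: cF.
Qed.

Lemma continuous_at_prod (I : Type) (r : seq I) (P : pred I) (F : I -> T -> R) :
  (forall i, {for x, continuous (F i)}) ->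
  {for x, continuous (fun y => \prod_(i <- r | P i) F i y)}.
Proof.
by move=> cF; apply: (cvg_big (@mul_continuous R)) => i _; exact: cF.
Qed.

Definition entries_continuous m n (M : T -> 'M[R]_(m, n)) :=
  forall i j, {for x, continuous (fun y => M y i j)}.

Lemma entries_continuous_det n (M : T -> 'M[R]_n) :
  entries_continuous M -> {for x, continuous (fun y => \det (M y))}.
Proof.
move=> cM; apply: continuous_at_sum => s.
apply: continuousM; first exact: cst_continuous.
by apply: continuous_at_prod => i; exact: cM.
Qed.

Lemma entries_continuous_adj n (M : T -> 'M[R]_n) :
  entries_continuous M -> entries_continuous (fun y => \adj (M y)).
Proof.
move=> cM i j; rewrite (_ : (fun y => _) = (fun y => cofactor (M y) j i)).
  apply: continuousM; first exact: cst_continuous.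
  apply: entries_continuous_det => k l.
  rewrite (_ : (fun y => _) = (fun y => M y (lift j k) (lift i l))) //.
  by apply/funext => y; rewrite !mxE.
by apply/funext => y; rewrite mxE.
Qed.

Lemma entries_continuous_mul m n p (M : T -> 'M[R]_(m, n)) (N : T -> 'M[R]_(n, p)) :
  entries_continuous M -> entries_continuous N ->
  entries_continuous (fun y => M y *m N y).
Proof.
move=> cM cN i j.
rewrite (_ : (fun y => _) = (fun y => \sum_k M y i k * N y k j)).
  by apply: continuous_at_sum => k; apply: continuousM; [exact: cM|exact: cN].
by apply/funext => y; rewrite mxE.
Qed.

Lemma entries_continuous_tr m n (M : T -> 'M[R]_(m, n)) :
  entries_continuous M -> entries_continuous (fun y => (M y)^T).
Proof.
move=> cM i j; rewrite (_ : (fun y => _) = (fun y => M y j i)) //.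
by apply/funext => y; rewrite mxE.
Qed.

Lemma continuous_at_linear_row (V : normedModType R) n
    (L : {linear 'rV[R]_n -> V}) (r : T -> 'rV[R]_n) :
  entries_continuous r -> {for x, continuous (fun y => L (r y))}.
Proof.
move=> cr.
rewrite (_ : (fun y => _) = (fun y => \sum_k r y 0 k *: L (delta_mx 0 k))).
  apply: continuous_at_sum => k; apply: continuousZl; exact: cr.
apply/funext => y; rewrite {1}(row_sum_delta (r y)) linear_sum.
by apply: eq_bigr => k _; rewrite linearZ.
Qed.
End ContinuousMatrices.

(** * The index of semi-explicit systems *)

Lemma derive1_line (R : realType) (E : normedModType R) (h : E -> R) (x v : E) :
  derive1 (fun s : R => h (x + s *: v)) 0 = 'D_v h x.
Proof.
rewrite derive1E /derive.
set f := (f in _ = lim (f @ _)); set f' := (f in lim (f @ _) = _).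
suff -> : f' = f by [].
apply/funext => s; rewrite /f /f' /=.
by rewrite scale0r !addr0 [s *: 1]mulr1 [x + _]addrC.
Qed.

(** Along a line a polynomial of degree at most two shows its directional
    derivative as its linear coefficient. *)
Lemma derive_quadratic (R : realType) (E : normedModType R) (h : E -> R)
    (x v : E) (d q : R) :
  (forall s : R, h (x + s *: v) = h x + s * d + s ^+ 2 * q) -> 'D_v h x = d.
Proof.
move=> hE; rewrite -derive1_line derive1E.
rewrite (_ : (fun s => _) = (fun s : R => h x + s * d + s ^+ 2 * q)); last exact/funext.
by apply: derive_val; apply: is_derive_eq; rewrite /GRing.scale /=; ring.
Qed.

Lemma pair0_linear_row (R : realType) (V : normedModType R) n
    (L : {linear 'rV[R]_n -> V}) (u : 'rV[R]_n) :
  (0, L u) = \sum_k u 0 k *: (0, L (delta_mx 0 k)) :> R * V.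
Proof.
rewrite {1}(row_sum_delta u) linear_sum.
rewrite (big_morph (fun v : V => (0, v) : R * V) (id1 := 0) (op1 := +%R)) //; last first.
  by move=> v v'; congr pair; rewrite /= addr0.
by apply: eq_bigr => k _; rewrite linearZ; congr pair; rewrite /= scaler0.
Qed.

(** The images of [iota1] and [iota2] are the spaces of the differential and of
    the algebraic variables. The equations prescribe the differential part of
    the derivative of the state, and imply in addition finitely many equations
    [g c (t, z) = 0]. *)
Section SemiExplicit.
Variables (R : realType) (V : normedModType R) (E : Type).
Variables (F : E -> R -> V -> V -> R) (I : set R) (z : R -> V).
Variables (n m : nat) (C : finType).
Variables (iota1 : {linear 'rV[R]_n -> V}) (iota2 : {linear 'rV[R]_m -> V}).
Variables (f : 'I_n -> R * V -> R) (g : C -> R * V -> R).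

Let U0 : set (R * V) := [set x | I x.1].

Hypothesis I_open : open I.
Hypothesis f_C1 : forall a, Cn 1 U0 (f a).
Hypothesis g_C1 : forall c, Cn 1 U0 (g c).
Hypothesis differential_part : forall t v v', (forall e, F e t v v' = 0) ->
  exists u, v' = iota1 (\row_a f a (t, v)) + iota2 u.
Hypothesis algebraic_part : forall c, exists e,
  forall t v v', F e t v v' = g c (t, v).
Hypothesis jacobian_injective : forall t u, I t ->
  (forall c, 'D_(0, iota2 u) (g c) (t, z t) = 0) -> u = 0.

Let J (x : R * V) : 'M[R]_(m, #|C|) :=
  \matrix_(k, c) 'D_(0, iota2 (delta_mx 0 k)) (g (enum_val c)) x.

Let b (x : R * V) : 'rV[R]_#|C| :=
  \row_c - ('D_(1, 0) (g (enum_val c)) x +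
    \sum_a f a x * 'D_(0, iota1 (delta_mx 0 a)) (g (enum_val c)) x).

Let D x := \det (J x *m (J x)^T).

Let U : set (R * V) := [set x | U0 x /\ D x != 0].

Let phi x : V := iota1 (\row_a f a x) +
  iota2 ((D x)^-1 *: (b x *m (J x)^T *m \adj (J x *m (J x)^T))).

Let U0_open : open U0.
Proof. by apply: (open_comp (f := fst)) => // x _; exact: cvg_fst. Qed.

Let derive_row k (L : {linear 'rV[R]_k -> V}) u c x : U0 x ->
  'D_(0, L u) (g c) x = \sum_i u 0 i * 'D_(0, L (delta_mx 0 i)) (g c) x.
Proof.
move=> Ux; rewrite pair0_linear_row (C1_derive_sum _ _ (g_C1 c)) //.
by apply: eq_bigr => i _; rewrite (C1_deriveZ _ _ (g_C1 c)).
Qed.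

Let J_continuous x : U0 x -> entries_continuous x J.
Proof.
move=> Ux k c; rewrite (_ : (fun y => _) =
  (fun y => 'D_(0, iota2 (delta_mx 0 k)) (g (enum_val c)) y)).
  by have [_ /(_ (0, iota2 (delta_mx 0 k)))] := g_C1 (enum_val c); exact.
by apply/funext => y; rewrite mxE.
Qed.

Let gram_continuous x : U0 x -> entries_continuous x (fun y => J y *m (J y)^T).
Proof.
move=> Ux; apply: entries_continuous_mul; last apply: entries_continuous_tr;
  exact: J_continuous.
Qed.

Let D_continuous x : U0 x -> {for x, continuous D}.
Proof. by move=> Ux; exact: entries_continuous_det (gram_continuous Ux). Qed.

Let b_continuous x : U0 x -> entries_continuous x b.
Proof.
move=> Ux i c; pose gc := g (enum_val c).
rewrite (_ : (fun y => _) = (fun y => - ('D_(1, 0) gc y +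
  \sum_a f a y * 'D_(0, iota1 (delta_mx 0 a)) gc y))); last first.
  by apply/funext => y; rewrite mxE.
have Dc v : {for x, continuous (fun y => 'D_v gc y)}.
  by have [_ /(_ v)] := g_C1 (enum_val c); exact.
apply: continuousN; apply: continuousD => //.
apply: continuous_at_sum => a; apply: continuousM => //.
exact: C1_continuous (f_C1 a) Ux.
Qed.

Let phi_continuous x : U x -> {for x, continuous phi}.
Proof.
move=> [Ux Dx]; apply: continuousD; apply: continuous_at_linear_row.
  move=> i a; rewrite (_ : (fun y => _) = f a).
    exact: C1_continuous (f_C1 a) Ux.
  by apply/funext => y; rewrite mxE.
pose W y := b y *m (J y)^T *m \adj (J y *m (J y)^T).
move=> i k; rewrite (_ : (fun y => _) = (fun y => (D y)^-1 * W y i k)); last first.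
  by apply/funext => y; rewrite mxE.
apply: continuousM.
  by apply: continuousV => //; exact: D_continuous.
apply: entries_continuous_mul.
  apply: entries_continuous_mul; first exact: b_continuous.
  by apply: entries_continuous_tr; exact: J_continuous.
by apply: entries_continuous_adj; exact: gram_continuous.
Qed.

Let U_open : open U.
Proof.
rewrite openE => x [Ux Dx]; apply: filterI.
  exact: open_nbhs_nbhs.
by apply: (cvgr_neq0 _ (D_continuous Ux)).
Qed.

(** Along a solution [dg/dt = 0] is a linear system for the algebraic part of the
    derivative, with matrix [J] and right-hand side [b], both continuous in the
    state. Injectivity of the Jacobian on the solution makes the Gram
    determinant nonzero there, hence on a neighbourhood. *)
Lemma semi_explicit_determined : determines_derivative F I z 1.
Proof.
exists U, phi; split=> //.
- split=> // t It; split=> //; apply: gram_det_neq0 => u uJ.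
  apply: (jacobian_injective It) => c.
  rewrite derive_row //; have /rowP/(_ (enum_rank c)) := uJ.
  rewrite !mxE; under eq_bigr do rewrite !mxE enum_rankK.
  by [].
- move=> t w [It Dx] Fw; set x := (t, w 0%N) in Dx *.
  have F0 e : F e t (w 0%N) (w 1%N) = 0 by exact: (Fw 0%N).
  have [u wu] := differential_part F0.
  suff uJ : u *m J x = b x by rewrite wu /phi -(least_squares Dx uJ).
  apply/rowP => c; set gc := enum_val c.
  have [e Fe] := algebraic_part gc.
  (* The total derivative is the derivative in the direction (1, z'). *)
  have : 'D_(1, w 1%N) (g gc) x = 0.
    rewrite -derive1_line -[RHS](Fw 1%N e) //=.
    congr (derive1 _ _); apply/funext => s; rewrite /= Fe; congr (g gc (_, _)).
    by rewrite /= [s *: 1]mulr1.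
  have -> : (1, w 1%N) = (1, 0) + ((0, iota1 (\row_a f a x)) + (0, iota2 u)) :> R * V.
    by rewrite wu; congr pair; rewrite /= ?addr0 ?add0r.
  rewrite !(C1_deriveD _ _ (g_C1 gc)) // !derive_row // addrA => h.
  rewrite !mxE; apply/eqP; rewrite -subr_eq0 opprK addrC; apply/eqP.
  rewrite -[RHS]h; congr (_ + _ + _); apply: eq_bigr => k _; rewrite !mxE //.
Qed.
End SemiExplicit.

(** * The boundary of the network *)

Section Topology.
Variables (R : realType) (G : network R).
Hypothesis top : topology_ok G.

Local Notation pipe := 'I_(npred G).+1.
Local Notation interior := (Defs.interior G).

Lemma boundary_end (i : pipe) b : pipe_end i b \notin interior ->
  pipe_end i b \in if b then demand G else supply G.
Proof.
rewrite finset.in_setC negbK finset.in_setU => /orP[|] j_in.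
  have [_ /cards0_eq /setP/(_ i)] := supply_pipe top j_in.
  by case: b j_in => //= j_in; rewrite !inE eqxx.
have [_ /cards0_eq /setP/(_ i)] := demand_pipe top j_in.
by case: b j_in => //= j_in; rewrite !inE eqxx.
Qed.

(** Each boundary node is attached to a single pipe. *)
Lemma boundary_end_inj (i i' : pipe) b b' : pipe_end i b \notin interior ->
  pipe_end i b = pipe_end i' b' -> i = i' /\ b = b'.
Proof.
move=> iN e; have := boundary_end iN.
have := boundary_end (i := i') (b := b'); rewrite -e => /(_ iN).
have dis j : j \in supply G -> j \in demand G -> False.
  by move=> js jd; rewrite (disjointFr (supply_demand_disjoint top) js) in jd.
case: b b' e {iN} => [] [] /= e h h'; try by case: (dis _ h h') || case: (dis _ h' h).
  have [/eqP/cards1P[k ek] _] := demand_pipe top h; split=> //.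
  have /setP/(_ i) := ek; have /setP/(_ i') := ek.
  by rewrite !inE -e eqxx => /esym/eqP-> /esym/eqP.
have [/eqP/cards1P[k ek] _] := supply_pipe top h; split=> //.
have /setP/(_ i) := ek; have /setP/(_ i') := ek.
by rewrite !inE -e eqxx => /esym/eqP-> /esym/eqP.
Qed.

Lemma supply_notin_interior j : j \in supply G -> j \notin interior.
Proof. by move=> js; rewrite finset.in_setC negbK finset.in_setU js. Qed.

Lemma source_after_notin_interior (k : 'I_(nconsumers G)) :
  source (after k) \notin interior.
Proof.
by apply: supply_notin_interior; have /setIP[] := consumer_supply top k.
Qed.

(** There are as many supply nodes as units, and the supply nodes after
    different units differ. *)
Lemma supply_node_after_unit j : j \in supply G ->
  j = source (ord0 : pipe) \/ exists k, j = source (after k).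
Proof.
move=> js.
pose S := source (ord0 : pipe) |: [set source (after k) | k in 'I_(nconsumers G)].
suff : j \in S.
  by rewrite !inE => /orP[/eqP|/imsetP[k _]]; [left|right; exists k].
suff -> : S = supply G by [].
have /setIP[s0 n0] := plant_supply top.
apply/eqP; rewrite eqEcard; apply/andP; split.
  apply/fintype.subsetP => x; rewrite !inE => /orP[/eqP->//|/imsetP[k _ ->]].
  by have /setIP[] := consumer_supply top k.
rewrite (card_supply top) cardsU1 card_imset ?card_ord.
  case: imsetP => //= -[k _ e]; have /setIP[_] := consumer_supply top k.
  by rewrite -e inE n0.
move=> k k' e; apply: (after_inj top).
by case: (@boundary_end_inj (after k) (after k') false false
  (source_after_notin_interior k) e).
Qed.
End Topology.

(** * Velocities and pressures of the network *)

Section Network.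
Variables (R : realType) (G : network R).
Hypothesis top : topology_ok G.
Hypothesis par : parameters_ok G.
Hypothesis supply_tree : polytree (@edge R G) (supply_net G).
Hypothesis return_tree : polytree (@edge R G) (return_net G).
Hypothesis demand_before : demand_nodes_before_units G.

Local Notation pipe := 'I_(npred G).+1.
Local Notation interior := (Defs.interior G).
Local Notation plant_source := (source (ord0 : pipe)).
Local Notation plant_target := (target (ord_max : pipe)).

Lemma in_return j : (j \in return_net G) = (j \notin supply_net G).
Proof. by rewrite finset.in_setC. Qed.

Lemma return_closed (i : pipe) :
  (source i \in return_net G) = (target i \in return_net G).
Proof. by rewrite !in_return pipes_separated. Qed.

(** The only supply node of the supply network and the only demand node of the
    return network are at the power plant, so away from these two nodes the
    boundary of each network consists of nodes of a single kind. *)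
Lemma supply_boundary (i : pipe) b : pipe_end i b \in supply_net G ->
  pipe_end i b != plant_source -> pipe_end i b \notin interior ->
  b = true /\ exists k, i = before k.
Proof.
move=> iA nr iN; have := boundary_end top iN; case: b iA nr iN => /= iA nr iN h.
  split=> //; case: (demand_before h) => [e|[k e]].
    by have /setIP[_] := plant_demand top; rewrite in_return -e iA.
  exists k.
  by case: (boundary_end_inj top (i := i) (b := true) (b' := true) iN e).
case: (supply_node_after_unit top h) => [e|[k e]]; first by rewrite e eqxx in nr.
by have /setIP[_] := consumer_supply top k; rewrite in_return -e iA.
Qed.

Lemma return_boundary (i : pipe) b : pipe_end i b \in return_net G ->
  pipe_end i b != plant_target -> pipe_end i b \notin interior ->
  b = false /\ exists k, i = after k.
Proof.
rewrite in_return => iA nr iN.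
have := boundary_end top iN; case: b iA nr iN => /= iA nr iN h.
  case: (demand_before h) => [e|[k e]]; first by rewrite e eqxx in nr.
  by have /setIP[_] := consumer_demand top k; rewrite -e (negbTE iA).
split=> //; case: (supply_node_after_unit top h) => [e|[k e]].
  by have /setIP[_] := plant_supply top; rewrite -e (negbTE iA).
by exists k; case: (boundary_end_inj top (i := i) (b := false) (b' := false) iN e).
Qed.

Lemma area_gt0 (i : pipe) : 0 < area i.
Proof. by rewrite mulr_gt0 ?pi_gt0 // exprn_gt0 // divr_gt0 // (diam_gt0 par). Qed.

Lemma flow_coef_gt0 (i : pipe) : 0 < area i * rho G.
Proof. by rewrite mulr_gt0 ?area_gt0 // (rho_gt0 par). Qed.

Section Velocities.
Variable v : X2 G.
Hypothesis v_conserved : forall j, j \in interior ->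
  \sum_(i in entering j) area i * rho G * vel v i =
  \sum_(i in leaving j) area i * rho G * vel v i.
Hypothesis v_consumer : forall k, vel v (before k) = vel v (after k).

Let flow i := area i * rho G * vel v i.

Lemma velocities_eq0 : (forall k, vel v (before k) = 0) -> v = 0.
Proof.
move=> v0; suff flow0 i : flow i = 0.
  apply/rowP => i; have /eqP := flow0 i.
  by rewrite mulf_eq0 gt_eqF ?flow_coef_gt0 //= mxE => /eqP.
have [iS|iR] := boolP (source i \in supply_net G).
  apply: (zero_flow (no_parallel_pipes top) (pipes_separated top) supply_tree
    v_conserved) iS => {}i b iA nr iN.
  by have [_ [k ->]] := supply_boundary iA nr iN; rewrite /flow v0 mulr0.
rewrite -in_return in iR.
apply: (zero_flow (no_parallel_pipes top) return_closed return_tree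
  v_conserved) iR => {}i b iA nr iN.
by have [_ [k ->]] := return_boundary iA nr iN; rewrite /flow -v_consumer v0 mulr0.
Qed.

Lemma velocities_gt0 : (forall i, 0 <= vel v i) ->
  (forall k, 0 < vel v (before k)) -> forall i, 0 < vel v i.
Proof.
move=> v_ge0 v_gt0 i; have flow_ge0 k : 0 <= flow k.
  by rewrite mulr_ge0 // ltW // flow_coef_gt0.
rewrite -(pmulr_rgt0 _ (flow_coef_gt0 i)) -/(flow i).
have [iS|iR] := boolP (source i \in supply_net G).
  apply: (positive_flow (no_parallel_pipes top) (pipes_separated top) supply_tree
    v_conserved (b0 := true) flow_ge0 (interior_pipes top)) iS => {}i b iA nr iN.
  have [-> [k ->]] := supply_boundary iA nr iN; split=> //.
  by rewrite /flow pmulr_rgt0 ?flow_coef_gt0.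
rewrite -in_return in iR.
apply: (positive_flow (no_parallel_pipes top) return_closed return_tree
  v_conserved (b0 := false) flow_ge0 (interior_pipes top)) iR => {}i b iA nr iN.
have [-> [k ->]] := return_boundary iA nr iN; split=> //.
by rewrite /flow pmulr_rgt0 ?flow_coef_gt0 // -v_consumer.
Qed.
End Velocities.

Section Pressures.
Variable q : pipe * bool -> R.
Hypothesis q_pipe : forall i, q (i, true) = q (i, false).
Hypothesis q_node : forall i i' b b', pipe_end i b \in interior ->
  pipe_end i b = pipe_end i' b' -> q (i, b) = q (i', b').

(** The underlying graph is connected, and a zero pressure spreads along each
    pipe and across each node. *)
Lemma net_pressures_eq0 (A : {set node G}) i0 b0 :
  undirected_tree (@edge R G) A -> pipe_end i0 b0 \in A ->
  q (i0, b0) = 0 -> forall i b, pipe_end i b \in A -> q (i, b) = 0.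
Proof.
move=> [_ conn _] i0A q0 i b iA.
have node_eq i1 i2 b1 b2 : pipe_end i1 b1 = pipe_end i2 b2 -> q (i1, b1) = q (i2, b2).
  move=> e; have [inn|iN] := boolP (pipe_end i1 b1 \in interior).
    exact: q_node.
  by have [-> ->] := boundary_end_inj top iN e.
have pipe_eq i1 b1 : q (i1, b1) = q (i1, ~~ b1) by case: b1.
have /connectP[p pp pe] := conn _ _ i0A iA.
elim: p i0 b0 q0 pp pe {i0A} => [|y p IH] i0 b0 q0 /=.
  by move=> _ e; rewrite (node_eq _ _ _ _ e).
case/andP=> /und_pipeP[i1 [b1 [e1 e2]]] py pe.
apply: (IH i1 (~~ b1)); rewrite -?e2 //.
by rewrite -pipe_eq -(node_eq _ _ _ _ e1).
Qed.

Lemma pressures_eq0 : q (ord0, false) = 0 -> q (ord_max, true) = 0 ->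
  forall e, q e = 0.
Proof.
move=> qs qt [i b]; have [iS|iR] := boolP (pipe_end i b \in supply_net G).
  apply: (net_pressures_eq0 (i0 := ord0) (b0 := false)) iS => //.
    by have [] := supply_tree.
  by have /setIP[] := plant_supply top.
rewrite -in_return in iR.
apply: (net_pressures_eq0 (i0 := ord_max) (b0 := true)) iR => //.
  by have [] := return_tree.
by have /setIP[] := plant_demand top.
Qed.
End Pressures.
End Network.

(** * Smoothness of the equations *)

(** The pattern by which the equality of [n] quantities is imposed with [n.-1]
    equations. *)
Lemma nth_head_eq (T : eqType) (R : zmodType) (q : T -> R) x0 (s : seq T) :
  (forall k : 'I_(size s).-1, q (nth x0 s 0) = q (nth x0 s k.+1)) ->
  {in s &, forall x y, q x = q y}.
Proof.
move=> qs; suff h x : x \in s -> q (nth x0 s 0) = q x by move=> x y /h <- /h <-.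
move=> xs; rewrite -[in RHS](nth_index x0 xs).
have := xs; rewrite -index_mem; case: (index x s) => [//|k] ks.
have ks' : (k < (size s).-1)%N by rewrite -ltnS prednK // (leq_trans _ ks).
exact: (qs (Ordinal ks')).
Qed.

Lemma continuous_fst (T : topologicalType) (V W : topologicalType) (p : T -> V * W) :
  continuous p -> continuous (fun x => (p x).1).
Proof. by move=> cp x; apply: (continuous_comp (cp x)); exact: cvg_fst. Qed.

Lemma continuous_snd (T : topologicalType) (V W : topologicalType) (p : T -> V * W) :
  continuous p -> continuous (fun x => (p x).2).
Proof. by move=> cp x; apply: (continuous_comp (cp x)); exact: cvg_snd. Qed.

Lemma C1_entry (R : realType) (E : normedModType R) n (p : E -> 'rV[R]_n) k (U : set E) :
  linear p -> continuous p -> Cn 1 U (fun x => p x 0 k).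
Proof.
move=> plin cp; apply: C1_linear => [c x y|x]; first by rewrite plin !mxE.
exact: (continuous_comp (cp x) (@coord_continuous _ _ _ _ _ _)).
Qed.

Lemma C1_fst (R : realType) (E E' : normedModType R) (U : set E) (f : E -> R) :
  Cn 1 U f -> Cn 1 [set x : E * E' | U x.1] (fun x => f x.1).
Proof.
move=> f_C1; apply: (C1_comp_linear (L := fst : E * E' -> E) _ _ f_C1).
  exact: (fun _ _ _ => erefl).
by move=> x; exact: cvg_fst.
Qed.

Lemma C1_snd (R : realType) (E E' : normedModType R) (U : set E') (f : E' -> R) :
  Cn 1 U f -> Cn 1 [set x : E * E' | U x.2] (fun x => f x.2).
Proof.
move=> f_C1; apply: (C1_comp_linear (L := snd : E * E' -> E') _ _ f_C1).
  exact: (fun _ _ _ => erefl).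
by move=> x; exact: cvg_snd.
Qed.

Section Equations.
Variables (R : realType) (G : network R).
Variables (Q : 'I_(nconsumers G) -> R -> R) (Tin pin pret : R -> R) (I : set R).

Local Notation pipe := 'I_(npred G).+1.
Local Notation interior := (Defs.interior G).
Local Notation dae := (@dae R G Q Tin pin pret).
Local Notation W := (R * state G)%type.
Local Notation U0 := ([set x : W | I x.1]).

Hypothesis I_open : open I.
Hypothesis Q_C1 : forall k, Cn 1 I (Q k).
Hypothesis Tin_C1 : Cn 1 I Tin.
Hypothesis pin_C1 : Cn 1 I pin.
Hypothesis pret_C1 : Cn 1 I pret.

Lemma U0_open : open U0.
Proof. by apply: (open_comp (f := fst)) => // x _; exact: cvg_fst. Qed.

Lemma time_C1 (h : R -> R) : Cn 1 I h -> Cn 1 U0 (fun x : W => h x.1).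
Proof. exact: C1_fst. Qed.

Lemma Tgrid_C1 a : Cn 1 U0 (fun x : W => Tgrid x.2.1.1 a).
Proof.
apply: (C1_entry (p := fun x : W => x.2.1.1)); first exact: (fun _ _ _ => erefl).
by apply: continuous_fst; apply: continuous_fst; apply: continuous_snd;
  move=> x; exact: cvg_id.
Qed.

Lemma vel_C1 i : Cn 1 U0 (fun x : W => vel x.2.1.2 i).
Proof.
apply: (C1_entry (p := fun x : W => x.2.1.2)); first exact: (fun _ _ _ => erefl).
by apply: continuous_snd; apply: continuous_fst; apply: continuous_snd;
  move=> x; exact: cvg_id.
Qed.

Lemma Tleft_C1 i : Cn 1 U0 (fun x : W => Tleft x.2.2 i).
Proof.
apply: (C1_entry (p := fun x : W => x.2.2.1.1)); first exact: (fun _ _ _ => erefl).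
by apply: continuous_fst; apply: continuous_fst; apply: continuous_snd; apply: continuous_snd;
  move=> x; exact: cvg_id.
Qed.

Lemma pleft_C1 i : Cn 1 U0 (fun x : W => pleft x.2.2 i).
Proof.
apply: (C1_entry (p := fun x : W => x.2.2.1.2)); first exact: (fun _ _ _ => erefl).
by apply: continuous_snd; apply: continuous_fst; apply: continuous_snd; apply: continuous_snd;
  move=> x; exact: cvg_id.
Qed.

Lemma pright_C1 i : Cn 1 U0 (fun x : W => pright x.2.2 i).
Proof.
apply: (C1_entry (p := fun x : W => x.2.2.2)); first exact: (fun _ _ _ => erefl).
by apply: continuous_snd; apply: continuous_snd; apply: continuous_snd;
  move=> x; exact: cvg_id.
Qed.

Lemma pressure_C1 e : Cn 1 U0 (fun x : W => pressure x.2.2 e).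
Proof. by case: e => i []; [exact: pright_C1|exact: pleft_C1]. Qed.

Lemma temp_C1 i j : Cn 1 U0 (fun x : W => temp (i := i) x.2.1.1 x.2.2 j).
Proof. by rewrite /temp; case: unlift => [j'|]; [exact: Tgrid_C1|exact: Tleft_C1]. Qed.

Ltac C1_tac := lazymatch goal with
  | |- Cn 1 _ (fun x => (@?f x + @?g x)%R) => apply: (C1D U0_open); C1_tac
  | |- Cn 1 _ (fun x => (- @?f x)%R) => apply: (C1N U0_open); C1_tac
  | |- Cn 1 _ (fun x => (@?f x * @?g x)%R) => apply: (C1M U0_open); C1_tac
  | |- Cn 1 _ (fun x => (@?f x ^+ _)%R) => apply: (C1X U0_open); C1_tac
  | |- Cn 1 _ (fun x => \sum_(i in _) _) => apply: (C1_sum U0_open) => i; C1_tac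
  | |- Cn 1 _ (fun x => vel _ _) => exact: vel_C1
  | |- Cn 1 _ (fun x => Tgrid _ _) => exact: Tgrid_C1
  | |- Cn 1 _ (fun x => Tleft _ _) => exact: Tleft_C1
  | |- Cn 1 _ (fun x => pleft _ _) => exact: pleft_C1
  | |- Cn 1 _ (fun x => pright _ _) => exact: pright_C1
  | |- Cn 1 _ (fun x => pressure _ _) => exact: pressure_C1
  | |- Cn 1 _ (fun x => temp _ _ _) => exact: temp_C1
  | |- Cn 1 _ (fun x => Q _ _) => exact: (time_C1 (Q_C1 _))
  | _ => first [exact: C1_cst | by apply: time_C1]
  end.

Lemma f1_C1 a : Cn 1 U0 (fun x : W => f1 a x.1 x.2.1.1 x.2.1.2 x.2.2).
Proof. rewrite /f1; C1_tac. Qed.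

Lemma f2_C1 i : Cn 1 U0 (fun x : W => f2 i x.1 x.2.1.1 x.2.1.2 x.2.2).
Proof. rewrite /f2; C1_tac. Qed.

Lemma g1_C1 e : Cn 1 U0 (fun x : W => g1 Tin pin pret e x.1 x.2.1.1 x.2.1.2 x.2.2).
Proof. case: e => *; rewrite /g1 /Tright; C1_tac. Qed.

Lemma g2_C1 e : Cn 1 U0 (fun x : W => g2 Q e x.1 x.2.1.1 x.2.1.2).
Proof. case: e => *; rewrite /g2 /Tright; C1_tac. Qed.

Definition algebraic (e : dae_eqn G) := if e is Eqn_f1 _ then false else true.

Lemma algebraic_eqn_C1 e : algebraic e -> Cn 1 U0 (fun x : W => dae e x.1 x.2 0).
Proof.
have daeE : (fun x : W => dae e x.1 x.2 0) = (fun x : W => match e with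
  | Eqn_f1 a => Tgrid 0 a - f1 a x.1 x.2.1.1 x.2.1.2 x.2.2
  | Eqn_f2 i => f2 i x.1 x.2.1.1 x.2.1.2 x.2.2
  | Eqn_g1 e => g1 Tin pin pret e x.1 x.2.1.1 x.2.1.2 x.2.2
  | Eqn_g2 e => g2 Q e x.1 x.2.1.1 x.2.1.2
  end) by apply/funext => -[t [[a b] y]].
by rewrite daeE; case: e {daeE} => // e _;
  [exact: f2_C1|exact: g1_C1|exact: g2_C1].
Qed.

Lemma dae_C1 e : Cn 1 (fun x : R * state G * state G => U0 x.1)
  (fun x : R * state G * state G => dae e x.1.1 x.1.2 x.2).
Proof.
have fst_C1 (h : W -> R) : Cn 1 U0 h ->
    Cn 1 (fun x : R * state G * state G => U0 x.1) (fun x => h x.1).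
  exact: C1_fst.
have [ea|] := boolP (algebraic e).
  rewrite (_ : (fun x => _) = (fun x : W * state G => dae e x.1.1 x.1.2 0)).
    exact: (fst_C1 (fun x => dae e x.1 x.2 0)) (algebraic_eqn_C1 ea).
  by apply/funext => -[[t [[a b] y]] z']; case: e ea.
case: e => // a _.
rewrite (_ : (fun x => _) = (fun x : W * state G =>
    Tgrid x.2.1.1 a - f1 a x.1.1 x.1.2.1.1 x.1.2.1.2 x.1.2.2)); last first.
  by apply/funext => -[[t [[? ?] y]] z'].
apply: C1B; last exact: fst_C1 (f1_C1 a).
  apply: (open_comp (f := fst)); last exact: U0_open.
  by move=> x _; exact: cvg_fst.
apply: (@C1_subset _ _ [set x : W * state G | [set: state G] x.2]) => //.
apply: (@C1_snd _ _ _ [set: state G] (fun z => Tgrid z.1.1 a)).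
apply: (C1_entry (p := fun z : state G => z.1.1)); first exact: (fun _ _ _ => erefl).
by apply: continuous_fst; apply: continuous_fst; move=> z; exact: cvg_id.
Qed.
End Equations.

(** * Injectivity of the linearized algebraic equations *)

Section Linearization.
Variables (R : realType) (G : network R).
Variables (Q : 'I_(nconsumers G) -> R -> R) (Tin pin pret : R -> R).
Local Notation dae := (@dae R G Q Tin pin pret).
Local Notation interior := (Defs.interior G).
Local Notation pipe := 'I_(npred G).+1.

Variables (t : R) (x1 : X1 G) (x2 : X2 G) (y : Y G) (dv : X2 G) (dy : Y G).

Definition in_kernel (e : dae_eqn G) :=
  'D_(0, (0, dv, dy)) (fun x : R * state G => dae e x.1 x.2 0) (t, (x1, x2, y)) = 0.

(** Along a line every algebraic equation is a polynomial of degree at most two,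
    so its linearization can be read off without computing derivatives. *)
Lemma in_kernel_quadratic e d q : in_kernel e ->
  (forall s : R, dae e t (x1, x2 + s *: dv, y + s *: dy) 0 =
     dae e t (x1, x2, y) 0 + s * d + s ^+ 2 * q) -> d = 0.
Proof.
move=> <- dE; apply/esym/(derive_quadratic (q := q)) => s.
have -> : (t, (x1, x2, y)) + s *: (0, (0, dv, dy)) =
  (t, (x1, x2 + s *: dv, y + s *: dy)) :> R * state G.
  congr pair; first by rewrite /= scaler0 addr0.
  by congr pair; congr pair; rewrite /= scaler0 addr0.
exact: dE.
Qed.

Lemma velE s i : vel (x2 + s *: dv) i = vel x2 i + s * vel dv i.
Proof. by rewrite /vel !mxE. Qed.

Lemma TleftE s i : Tleft (y + s *: dy) i = Tleft y i + s * Tleft dy i.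
Proof. by rewrite /Tleft !mxE. Qed.

Lemma pleftE s i : pleft (y + s *: dy) i = pleft y i + s * pleft dy i.
Proof. by rewrite /pleft !mxE. Qed.

Lemma prightE s i : pright (y + s *: dy) i = pright y i + s * pright dy i.
Proof. by rewrite /pright !mxE. Qed.

Lemma pressureE s e : pressure (y + s *: dy) e = pressure y e + s * pressure dy e.
Proof. by rewrite /pressure; case: e.2; rewrite ?prightE ?pleftE. Qed.

Lemma kernel_f2 i : in_kernel (Eqn_f2 i) ->
  (pressure dy (i, true) - pressure dy (i, false)) / (len i * rho G)
  + friction i / (2 * diam i) * (2 * vel x2 i * vel dv i) = 0.
Proof.
move=> k; apply: oppr_inj; rewrite oppr0.
apply: (in_kernel_quadratic (q := - (friction i / (2 * diam i) * vel dv i ^+ 2)) k) => s.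
by rewrite /= /f2 prightE pleftE velE /pressure /=; ring.
Qed.

Lemma kernel_pressure j (jn : j \in interior) n :
  in_kernel (Eqn_g1 (Pressure_continuity jn n)) ->
  pressure dy (nth (ord0, false) (ends_at j) 0) =
  pressure dy (nth (ord0, false) (ends_at j) n.+1).
Proof.
move=> k; apply: subr0_eq; apply: (in_kernel_quadratic (q := 0) k) => s.
by rewrite /= !pressureE; ring.
Qed.

Lemma kernel_mixing j (jn : j \in interior) n :
  in_kernel (Eqn_g1 (Perfect_mixing jn n)) ->
  Tleft dy (nth ord0 (enum (leaving j)) 0) =
  Tleft dy (nth ord0 (enum (leaving j)) n.+1).
Proof.
move=> k; apply: subr0_eq; apply: (in_kernel_quadratic (q := 0) k) => s.
by rewrite /= !TleftE; ring.
Qed.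

(** The perturbations of the velocity and of the temperature both enter the
    energy balance; once the former vanishes, only leaving pipes contribute,
    the right end temperatures being differential variables. *)
Lemma kernel_energy j (jn : j \in interior) : dv = 0 ->
  in_kernel (Eqn_g1 (Energy_conservation jn)) ->
  \sum_(i in leaving j) heatcap G * area i * rho G * vel x2 i * Tleft dy i = 0.
Proof.
move=> dv0 k; apply: oppr_inj; rewrite oppr0.
apply: (in_kernel_quadratic (q := 0) k) => s.
rewrite /= mulr0 addr0 -addrA mulrN -opprD mulr_sumr -big_split /=.
congr (_ - _); apply: eq_bigr => i _; rewrite velE ?TleftE dv0 [vel 0 i]mxE; ring.
Qed.

Lemma kernel_inlet_temperature :
  in_kernel (Eqn_g1 (Inlet_temperature G)) -> Tleft dy ord0 = 0.
Proof.
move=> k; apply: (in_kernel_quadratic (q := 0) k) => s.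
by rewrite /= !TleftE; ring.
Qed.

Lemma kernel_inlet_pressure :
  in_kernel (Eqn_g1 (Inlet_pressure G)) -> pressure dy (ord0, false) = 0.
Proof.
move=> k; apply: (in_kernel_quadratic (q := 0) k) => s.
by rewrite /= pleftE /pressure /=; ring.
Qed.

Lemma kernel_return_pressure :
  in_kernel (Eqn_g1 (Return_pressure G)) -> pressure dy (ord_max, true) = 0.
Proof.
move=> k; apply: (in_kernel_quadratic (q := 0) k) => s.
by rewrite /= prightE /pressure /=; ring.
Qed.

Lemma kernel_consumer_temperature c :
  in_kernel (Eqn_g1 (Consumer_temperature c)) -> Tleft dy (after c) = 0.
Proof.
move=> k; apply: (in_kernel_quadratic (q := 0) k) => s.
by rewrite /= !TleftE; ring.
Qed.

Lemma kernel_mass j (jn : j \in interior) :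
  in_kernel (Eqn_g2 (Mass_conservation jn)) ->
  \sum_(i in entering j) area i * rho G * vel dv i =
  \sum_(i in leaving j) area i * rho G * vel dv i.
Proof.
move=> k; apply: subr0_eq; apply: (in_kernel_quadratic (q := 0) k) => s.
rewrite /= mulr0 addr0 mulrBr addrACA -opprD !mulr_sumr -!big_split /=.
by congr (_ - _); apply: eq_bigr => i _; rewrite velE; ring.
Qed.

Lemma kernel_consumer_flow c : rho G != 0 ->
  in_kernel (Eqn_g2 (Consumer_flow c)) -> vel dv (before c) = vel dv (after c).
Proof.
move=> rho0 k; apply: (mulfI rho0); apply: subr0_eq.
by apply: (in_kernel_quadratic (q := 0) k) => s; rewrite /= !velE; ring.
Qed.

Lemma kernel_consumer_power c :
  in_kernel (Eqn_g2 (Consumer_power c)) ->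
  heatcap G * area (before c) * rho G * vel dv (before c) *
    (Tright x1 (before c) - Tout G) = 0.
Proof.
move=> k; apply: oppr_inj; rewrite oppr0.
by apply: (in_kernel_quadratic (q := 0) k) => s; rewrite /= !velE; ring.
Qed.
End Linearization.

Section Kernel.
Variables (R : realType) (G : network R).
Variables (Q : 'I_(nconsumers G) -> R -> R) (Tin pin pret : R -> R).
Hypothesis top : topology_ok G.
Hypothesis par : parameters_ok G.
Hypothesis supply_tree : polytree (@edge R G) (supply_net G).
Hypothesis return_tree : polytree (@edge R G) (return_net G).
Hypothesis demand_before : demand_nodes_before_units G.
Local Notation interior := (Defs.interior G).
Local Notation pipe := 'I_(npred G).+1.

Lemma mem_ends_at (i : pipe) b j : ((i, b) \in ends_at j) = (pipe_end i b == j).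
Proof.
rewrite mem_cat; apply/orP/eqP => [[]/mapP[k]|e].
- by rewrite mem_enum inE => /eqP <- [-> ->].
- by rewrite mem_enum inE => /eqP <- [-> ->].
case: b e => /= e; [left|right]; apply/mapP; exists i => //;
  by rewrite mem_enum inE e.
Qed.

Variables (t : R) (x1 : X1 G) (x2 : X2 G) (y : Y G).
Hypothesis vel_gt0 : forall i, 0 < vel x2 i.
Hypothesis consumer_gap : forall k, Tright x1 (before k) - Tout G != 0.

(** The linearized equations are triangular: the powers and the mass balances
    determine the velocities, then the mixing and energy equations at the nodes
    the temperatures, then the pipes the pressures. *)
Lemma jacobian_kernel (dv : X2 G) (dy : Y G) :
  (forall e, algebraic e -> in_kernel Q Tin pin pret t x1 x2 y dv dy e) ->
  dv = 0 /\ dy = 0.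
Proof.
move=> ker.
have rho0 : rho G != 0 by rewrite gt_eqF // (rho_gt0 par).
have coef_gt0 (i : pipe) : 0 < heatcap G * area i * rho G.
  apply: mulr_gt0; last exact: rho_gt0 par.
  by apply: mulr_gt0; [exact: heatcap_gt0 par|exact: area_gt0].
have dv0 : dv = 0.
  apply: (velocities_eq0 top par supply_tree return_tree demand_before).
  - by move=> j jn; exact: kernel_mass (ker (Eqn_g2 (Mass_conservation jn)) isT).
  - by move=> k; exact: kernel_consumer_flow rho0 (ker (Eqn_g2 (Consumer_flow k)) isT).
  move=> k; have /eqP := kernel_consumer_power (ker (Eqn_g2 (Consumer_power k)) isT).
  rewrite mulf_eq0 (negbTE (consumer_gap k)) orbF mulf_eq0.
  by rewrite gt_eqF ?coef_gt0 //= => /eqP.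
have Tleft0 (i : pipe) : Tleft dy i = 0.
  have [inn|] := boolP (source i \in interior); last first.
    move=> iN; have := boundary_end top (i := i) (b := false) iN.
    move=> /(supply_node_after_unit top)[e|[k e]].
      have [-> _] := boundary_end_inj top (i := i) (b := false) (b' := false) iN e.
      exact: kernel_inlet_temperature (ker (Eqn_g1 (Inlet_temperature G)) isT).
    have [-> _] := boundary_end_inj top (i := i) (b := false) (b' := false) iN e.
    exact: kernel_consumer_temperature (ker (Eqn_g1 (Consumer_temperature k)) isT).
  have mix : {in leaving (source i), forall l, Tleft dy l = Tleft dy i}.
    move=> l l_in; apply: (@nth_head_eq _ _ (Tleft dy) ord0 (enum (leaving (source i)))).
    - rewrite -cardE => k.
      exact: kernel_mixing (ker (Eqn_g1 (Perfect_mixing inn k)) isT).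
    - by rewrite mem_enum.
    - by rewrite mem_enum inE.
  have := kernel_energy dv0 (ker (Eqn_g1 (Energy_conservation inn)) isT).
  rewrite (eq_bigr (fun l =>
    heatcap G * area l * rho G * vel x2 l * Tleft dy i)); last first.
    by move=> l /mix ->.
  rewrite -mulr_suml => /eqP; rewrite mulf_eq0 gt_eqF /= => [/eqP //|].
  rewrite (bigD1 i) ?inE //=; apply: ltr_wpDr; last exact: mulr_gt0.
  by apply: sumr_ge0 => l _; apply: ltW; exact: mulr_gt0.
have p0 : forall e, pressure dy e = 0.
  apply: (pressures_eq0 top supply_tree return_tree).
  - move=> i; apply: subr0_eq.
    have := kernel_f2 (ker (Eqn_f2 i) isT); rewrite dv0 [vel 0 i]mxE !mulr0 addr0.
    move=> /eqP; rewrite mulf_eq0 => /orP[/eqP //|].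
    by rewrite invr_eq0 mulf_eq0 (negbTE rho0) gt_eqF // (len_gt0 par).
  - move=> i i' b b' inn e.
    apply: (@nth_head_eq _ _ (pressure dy) (ord0, false) (ends_at (pipe_end i b))).
    + move=> k.
      exact: kernel_pressure (ker (Eqn_g1 (Pressure_continuity inn k)) isT).
    + by rewrite mem_ends_at.
    + by rewrite mem_ends_at -e.
  - exact: kernel_inlet_pressure (ker (Eqn_g1 (Inlet_pressure G)) isT).
  - exact: kernel_return_pressure (ker (Eqn_g1 (Return_pressure G)) isT).
split=> //; case: dy Tleft0 p0 {ker} => [[dT dl] dr] Tleft0 p0.
congr (_, _, _); apply/rowP => i.
- by rewrite mxE; exact: Tleft0.
- by rewrite mxE; exact: (p0 (i, false)).
- by rewrite mxE; exact: (p0 (i, true)).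
Qed.
End Kernel.

(** * The index of the network equations *)

(** The least squares argument needs the algebraic equations to be indexed by a
    finite type. *)
Section Enumeration.
Variables (R : realType) (G : network R).
Local Notation pipe := 'I_(npred G).+1.
Local Notation interior_node := {j : node G | j \in Defs.interior G}.

Definition g1_code : finType :=
  ({j : interior_node & 'I_(size (ends_at (val j))).-1} +
   ({j : interior_node & 'I_#|leaving (val j)|.-1} +
    (interior_node + ('I_3 + 'I_(nconsumers G)))))%type.

Definition g2_code : finType :=
  (interior_node + ('I_(nconsumers G) + 'I_(nconsumers G)))%type.

Definition algebraic_code : finType := (pipe + (g1_code + g2_code))%type.

Definition g1_decode (c : g1_code) : g1_eqn G :=
  match c with
  | inl p => Pressure_continuity (valP (tag p)) (tagged p)
  | inr (inl p) => Perfect_mixing (valP (tag p)) (tagged p)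
  | inr (inr (inl j)) => Energy_conservation (valP j)
  (* The index 2 falls on the default value. *)
  | inr (inr (inr (inl n))) =>
      nth (Return_pressure G) [:: Inlet_temperature G; Inlet_pressure G] n
  | inr (inr (inr (inr k))) => Consumer_temperature k
  end.

Definition g2_decode (c : g2_code) : g2_eqn G :=
  match c with
  | inl j => Mass_conservation (valP j)
  | inr (inl k) => Consumer_flow k
  | inr (inr k) => Consumer_power k
  end.

Definition algebraic_decode (c : algebraic_code) : dae_eqn G :=
  match c with
  | inl i => Eqn_f2 i
  | inr (inl c) => Eqn_g1 (g1_decode c)
  | inr (inr c) => Eqn_g2 (g2_decode c)
  end.

Lemma algebraic_decoded c : algebraic (algebraic_decode c).
Proof. by case: c => [|[]]. Qed.

Lemma g1_decode_surj e : exists c, g1_decode c = e.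
Proof.
case: e => [j jn k|j jn k|j jn||||k].
- exists (inl (Tagged (fun j : interior_node => 'I_(size (ends_at (val j))).-1)
    (k : 'I_(size (ends_at (val (exist _ j jn : interior_node)))).-1))) => /=.
  by congr Pressure_continuity; exact: bool_irrelevance.
- exists (inr (inl (Tagged (fun j : interior_node => 'I_#|leaving (val j)|.-1)
    (k : 'I_#|leaving (val (exist _ j jn : interior_node))|.-1)))) => /=.
  by congr Perfect_mixing; exact: bool_irrelevance.
- exists (inr (inr (inl (exist _ j jn)))) => /=.
  by congr Energy_conservation; exact: bool_irrelevance.
- by exists (inr (inr (inr (inl (inord 0))))); rewrite /= inordK.
- by exists (inr (inr (inr (inl (inord 1))))); rewrite /= inordK.
- by exists (inr (inr (inr (inl (inord 2))))); rewrite /= inordK.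
- by exists (inr (inr (inr (inr k)))).
Qed.

Lemma g2_decode_surj e : exists c, g2_decode c = e.
Proof.
case: e => [j jn|k|k].
- exists (inl (exist _ j jn)) => /=.
  by congr Mass_conservation; exact: bool_irrelevance.
- by exists (inr (inl k)).
- by exists (inr (inr k)).
Qed.

Lemma algebraic_decode_surj e : algebraic e -> exists c, algebraic_decode c = e.
Proof.
case: e => // [i|e|e] _; first by exists (inl i).
  by have [c <-] := g1_decode_surj e; exists (inr (inl c)).
by have [c <-] := g2_decode_surj e; exists (inr (inr c)).
Qed.
End Enumeration.

Section Inclusions.
Variables (R : realType) (G : network R).
Local Notation n := (npred G).+1.

Definition differential_incl (u : 'rV[R]_#|{: gridpt G}|) : state G := (u, 0, 0).

Definition algebraic_incl (u : 'rV[R]_(n + (n + (n + n)))) : state G :=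
  (0, lsubmx u, (lsubmx (rsubmx u), lsubmx (rsubmx (rsubmx u)),
                 rsubmx (rsubmx (rsubmx u)))).

Lemma differential_incl_linear : linear differential_incl.
Proof. by move=> a u v; congr (_, _, _); rewrite /= scaler0 addr0. Qed.

Lemma algebraic_incl_linear : linear algebraic_incl.
Proof.
by move=> a u v; congr (_, _, (_, _, _)); rewrite /= ?scaler0 ?addr0 // !linearP.
Qed.

Lemma algebraic_incl_row v T l r :
  algebraic_incl (row_mx v (row_mx T (row_mx l r))) = (0, v, (T, l, r)).
Proof. by rewrite /algebraic_incl !(row_mxKr, row_mxKl). Qed.

HB.instance Definition _ :=
  GRing.isLinear.Build R 'rV[R]_#|{: gridpt G}| (state G) _ differential_incl
    differential_incl_linear.
HB.instance Definition _ :=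
  GRing.isLinear.Build R 'rV[R]_(n + (n + (n + n))) (state G) _ algebraic_incl
    algebraic_incl_linear.
End Inclusions.

Theorem lemma4 (R : realType) (G : network R)
    (Q : 'I_(nconsumers G) -> R -> R) (Tin pin pret : R -> R) (I : set R)
    (x1 : R -> X1 G) (x2 : R -> X2 G) (y : R -> Y G)
    (htopology : topology_ok G)
    (hparameters : parameters_ok G)
    (hsupply : polytree (@edge R G) (supply_net G))
    (hreturn : polytree (@edge R G) (return_net G))
    (hdemand : demand_nodes_before_units G)
    (hIopen : open I) (hIinterval : is_interval I) (hInonempty : I !=set0)
    (hQsmooth : forall k, Cn 1 I (Q k))
    (hTin : Cn 1 I Tin) (hpin : Cn 1 I pin) (hpret : Cn 1 I pret)
    (hQpos : forall k t, I t -> 0 < Q k t)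
    (hsol : dae_solution Q Tin pin pret I x1 x2 y)
    (hdirection : forall t i, I t -> 0 <= vel (x2 t) i) :
  differentiation_index (@dae R G Q Tin pin pret) I
    (fun t => (x1 t, x2 t, y t)) 1 /\
  forall t i, I t -> 0 < vel (x2 t) i.
Proof.
(* A positive power demand excludes both a zero velocity and a zero drop of
   temperature. *)
have power t k : I t -> 0 < vel (x2 t) (before k) /\
    Tright (x1 t) (before k) - Tout G != 0.
  move=> It; have [_ _ _ /(_ (Consumer_power k))/= /subr0_eq Qk] := hsol t It.
  have := hQpos k t It; rewrite Qk => /gt_eqF/negbT.
  rewrite !mulf_eq0 !negb_or => /andP[/andP[_ vk] ->]; split=> //.
  by rewrite lt_neqAle eq_sym vk hdirection.
have vel_gt0 t i : I t -> 0 < vel (x2 t) i.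
  move=> It; have [_ _ _ g2_0] := hsol t It.
  apply: (velocities_gt0 htopology hparameters hsupply hreturn hdemand).
  - by move=> j jn; exact: subr0_eq (g2_0 (Mass_conservation jn)).
  - move=> k; apply: (mulfI (lt0r_neq0 (rho_gt0 hparameters))).
    exact: subr0_eq (g2_0 (Consumer_flow k)).
  - by move=> l; exact: hdirection.
  - by move=> k; have [] := power t k It.
split=> //; split.
- exists [set x | I x.1]; split; last by move=> e; exact: dae_C1.
  by split=> //; exact: U0_open.
- apply: (@semi_explicit_determined R (state G) (dae_eqn G) _ I _ _ _
    (algebraic_code G) (@differential_incl R G) (@algebraic_incl R G)
    (fun a x => f1 (enum_val a) x.1 x.2.1.1 x.2.1.2 x.2.2)
    (fun c x => dae Q Tin pin pret (algebraic_decode c) x.1 x.2 0) hIopen).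
  + by move=> a; exact: f1_C1.
  + by move=> c; apply: algebraic_eqn_C1 => //; exact: algebraic_decoded.
  + move=> t [[z1 z2] z3] [[w1 w2] [[wT wl] wr]] F0.
    exists (row_mx w2 (row_mx wT (row_mx wl wr))).
    rewrite [X in _ + X](algebraic_incl_row w2 wT wl wr).
    congr (_, _, (_, _, _)); rewrite /= ?addr0 ?add0r //.
    apply/rowP => a; rewrite mxE.
    have /= /subr0_eq <- := F0 (Eqn_f1 (enum_val a)).
    by rewrite /Tgrid /= enum_valK.
  + move=> c; exists (algebraic_decode c) => t [[z1 z2] z3] w.
    by case: c => [|[]].
  + move=> t u It ker.
    have [||//|dv0 dy0] := @jacobian_kernel R G Q Tin pin pret htopology hparameters
      hsupply hreturn hdemand t (x1 t) (x2 t) (y t) _ _ (lsubmx u)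
      (lsubmx (rsubmx u), lsubmx (rsubmx (rsubmx u)), rsubmx (rsubmx (rsubmx u))).
    * by move=> i; exact: vel_gt0.
    * by move=> k; have [] := power t k It.
    * by move=> e /algebraic_decode_surj[c <-]; exact: ker.
    case: dy0 => T0 l0 r0.
    rewrite -[u]hsubmxK dv0 -[rsubmx u]hsubmxK T0.
    by rewrite -[rsubmx (rsubmx u)]hsubmxK l0 r0 !row_mx0.
move=> [|//] _ [U [phi [[_ nU] _ det]]].
have [t It] := hInonempty.
(* The undifferentiated equations hold for every derivative of the velocities,
   so these cannot be a function of the state. *)
pose dx1 : X1 G := \row_a f1 (enum_val a) t (x1 t) (x2 t) (y t).
have F0 (v : X2 G) e : dae Q Tin pin pret e t (x1 t, x2 t, y t) (dx1, v, 0) = 0.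
  have [_ f2_0 g1_0 g2_0] := hsol t It.
  case: e => [a|i|e|e] /=; rewrite ?f2_0 ?g1_0 ?g2_0 //.
  by rewrite /Tgrid /= mxE enum_rankK subrr.
have phiE (v : X2 G) : (dx1, v, 0) = phi (t, (x1 t, x2 t, y t)).
  apply: (det t (fun k => if k is 0%N then (x1 t, x2 t, y t) else (dx1, v, 0))).
    exact: nU.
  by move=> k e; rewrite leqn0 => /eqP ->; exact: F0.
have := phiE 0; rewrite -(phiE (const_mx 1)) => -[] /rowP/(_ ord0).
by rewrite !mxE => /eqP; rewrite eq_sym oner_eq0.
Qed.
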